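(* Let $R$ be a Noetherian local ring with maximal ideal $M$ and let $x \in M \setminus M^2$. Let $g: R \to R'$ be a homomorphism of commutative unital rings such that $x$ is a non-zero-divisor in $R$ and $g(x)$ is a non-zero-divisor in $R'$. Let $\mathcal{F}_{loc}$ be the principal localization square $$\mathcal{F}_{loc}:\qquad \begin{array}{ccc} R & \to & R_x \\ {\scriptstyle g}\downarrow & & \downarrow{\scriptstyle g_x} \\ R' & \to & R'_{g(x)}, \end{array}$$ and let $\bar g: R/(x) \to R'/(g(x))$ be the map induced by $g$. Then $\mathcal{F}_{loc}$ is a Milnor patching diagram if and only if - either $\bar g: R/(x) \to R'/(g(x))$ is an isomorphism; - or $R$ is a regular local ring of dimension $2$, $R'/(g(x))$ is isomorphic to the fraction field $k(R/(x))$, and (under this isomorphism) $\bar g: R/(x) \to R'/(g(x))$ is the standard inclusion $R/(x) \hookrightarrow k(R/(x))$.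
   Context: All rings are commutative and unital. $R_x = R[1/x]$ denotes localization at the powers of $x$, and $g_x: R_x \to R'_{g(x)}$ is the map induced by $g$; horizontal maps in the square are the localization maps. Let $\mathcal{F}$ be a commutative square of rings with maps $g_1: R \to R_1$, $g_2: R \to R_2$, $h_1: R_1 \to S$, $h_2: R_2 \to S$, $h_1 g_1 = h_2 g_2$. The category of patching data $\mathbf{PD}(\mathcal{F})$ has as objects triples $(M_1, M_2, \zeta)$ with $M_i$ an $R_i$-module ($i=1,2$) and $\zeta: M_1 \otimes_{R_1} S \to M_2 \otimes_{R_2} S$ an isomorphism of $S$-modules; morphisms $(M_1, M_2, \zeta) \to (M_1', M_2', \zeta')$ are pairs $(f_1, f_2)$ of $R_i$-linear maps $f_i: M_i \to M_i'$ with $\zeta' \circ (f_1 \otimes 1) = (f_2 \otimes 1) \circ \zeta$. An object $(M_1, M_2, \zeta)$ is said to have a property $P$ if both $M_1$ and $M_2$ have it. Define the functors $$\mathbf{F}_{\mathcal{F}}: R\text{-mod} \to \mathbf{PD}(\mathcal{F}),\quad M \mapsto (M \otimes_R R_1, M \otimes_R R_2, \mathrm{id}_{M \otimes_R S}),$$ $$\mathbf{G}_{\mathcal{F}}: \mathbf{PD}(\mathcal{F}) \to R\text{-mod},\quad (M_1, M_2, \zeta) \mapsto \{(m_1, m_2) \in M_1 \oplus M_2 : \zeta(m_1 \otimes 1) = m_2 \otimes 1\}.$$ The square $\mathcal{F}$ is a Milnor patching diagram if $\mathbf{F}_{\mathcal{F}}$ and $\mathbf{G}_{\mathcal{F}}$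 induce mutually inverse equivalences between the category of finitely generated projective $R$-modules and the category of finitely generated projective patching data (full subcategory of $\mathbf{PD}(\mathcal{F})$). For $\mathcal{F}_{loc}$ one takes $R_1 = R_x$, $R_2 = R'$, $S = R'_{g(x)}$. *)

(* Defs.v *)
(* All rings are [comPzRingType]s: commutative, unital, possibly zero.  The
   zero ring has to be allowed because a quotient R'/(g(x)) may vanish. *)
From HB Require Import structures.
From mathcomp Require Import all_boot all_algebra.
From mathcomp Require Import generic_quotient fraction zify ring.
From mathcomp Require Import boolp classical_sets.

Set Implicit Arguments.
Unset Strict Implicit.
Unset Printing Implicit Defensive.

Import GRing.Theory.
Local Open Scope classical_set_scope.
Local Open Scope ring_scope.
Local Open Scope quotient_scope.

Section Ideals.
Variable R : comPzRingType.
Implicit Types (I J P M : set R).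

Definition is_ideal I : Prop :=
  [/\ I 0, forall a b, I a -> I b -> I (a + b) & forall r a, I a -> I (r * a)].

Definition ideal_gen n (a : 'I_n -> R) : set R :=
  [set y | exists c : 'I_n -> R, y = \sum_(i < n) c i * a i].

Definition ideal_mul I J : set R :=
  [set y | exists n (a b : 'I_n -> R),
    [/\ forall i, I (a i), forall i, J (b i) & y = \sum_(i < n) a i * b i]].

Definition noetherian : Prop :=
  forall I, is_ideal I -> exists n (a : 'I_n -> R), I = ideal_gen a.

Definition prime_ideal P : Prop :=
  [/\ is_ideal P, ~ P 1 & forall a b, P (a * b) -> P a \/ P b].

Definition maximal_ideal M : Prop :=
  [/\ is_ideal M, ~ M 1 &
      forall J, is_ideal J -> ~ J 1 -> M `<=` J -> J = M].

Definition local_with M : Prop :=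
  maximal_ideal M /\ forall N, maximal_ideal N -> N = M.

Definition prime_chain n (p : 'I_n.+1 -> set R) : Prop :=
  (forall i, prime_ideal (p i)) /\
  (forall i j : 'I_n.+1, (i < j)%N -> p i `<` p j).

Definition has_krull_dim (d : nat) : Prop :=
  (exists p : 'I_d.+1 -> set R, prime_chain p) /\
  (forall n (p : 'I_n.+1 -> set R), prime_chain p -> (n <= d)%N).

Definition regular_local M (d : nat) : Prop :=
  [/\ noetherian, local_with M, has_krull_dim d &
      exists a : 'I_d -> R, M = ideal_gen a].

End Ideals.

Arguments noetherian R : clear implicits.
Arguments has_krull_dim R d : clear implicits.

(* The quotient R/(x).  The library's quotients by an ideal require a proper
   ideal, whereas here x may be a unit. *)
Section Quo.
Variables (R : comPzRingType) (x : R).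

Definition quo_rel (a b : R) : bool := `[< exists c, a - b = c * x >].

Lemma quo_rel_refl : reflexive quo_rel.
Proof. by move=> a; apply/asboolP; exists 0; rewrite subrr mul0r. Qed.

Lemma quo_rel_sym : symmetric quo_rel.
Proof.
suff h a b : quo_rel a b -> quo_rel b a by move=> a b; apply/idP/idP; apply: h.
by move=> /asboolP [c e]; apply/asboolP; exists (- c); rewrite mulNr -e opprB.
Qed.

Lemma quo_rel_trans : transitive quo_rel.
Proof.
move=> b a c /asboolP [u eu] /asboolP [v ev]; apply/asboolP; exists (u + v).
by rewrite mulrDl -eu -ev addrA subrK.
Qed.

Canonical quo_equiv := EquivRel quo_rel quo_rel_refl quo_rel_sym quo_rel_trans.

Definition quo : Type := {eq_quot quo_equiv}.
HB.instance Definition _ := Choice.on quo.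

Definition quo_class (a : R) : quo := \pi_({eq_quot quo_equiv}) a.

Lemma quo_classP a b : quo_class a = quo_class b <-> exists c, a - b = c * x.
Proof.
split=> [/eqmodP/asboolP // | h]; first by apply/eqmodP/asboolP.
Qed.

Lemma quo_ind (P : quo -> Prop) : (forall a, P (quo_class a)) -> forall q, P q.
Proof. by move=> h; elim/quotW; exact: h. Qed.

Definition quo_repr (q : quo) : R := repr (q : {eq_quot quo_equiv}).

Lemma quo_reprK q : quo_class (quo_repr q) = q.
Proof. exact: reprK. Qed.

Lemma quo_reprP a : exists c, quo_repr (quo_class a) - a = c * x.
Proof. by apply/quo_classP; rewrite quo_reprK. Qed.

Definition quo_add (p q : quo) := quo_class (quo_repr p + quo_repr q).
Definition quo_mul (p q : quo) := quo_class (quo_repr p * quo_repr q).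
Definition quo_opp (p : quo) := quo_class (- quo_repr p).

Lemma quo_addE a b : quo_add (quo_class a) (quo_class b) = quo_class (a + b).
Proof.
apply/quo_classP; have [c e] := quo_reprP a; have [d e'] := quo_reprP b.
by exists (c + d); rewrite mulrDl -e -e' opprD addrACA.
Qed.

Lemma quo_mulE a b : quo_mul (quo_class a) (quo_class b) = quo_class (a * b).
Proof.
apply/quo_classP; have [c e] := quo_reprP a; have [d e'] := quo_reprP b.
exists (c * quo_repr (quo_class b) + a * d).
by rewrite mulrDl -mulrA (mulrC _ x) mulrA -e -mulrA -e' mulrBl mulrBr addrA subrK.
Qed.

Lemma quo_oppE a : quo_opp (quo_class a) = quo_class (- a).
Proof.
apply/quo_classP; have [c e] := quo_reprP a.
by exists (- c); rewrite mulNr -e opprB opprK addrC.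
Qed.

Fact quo_addA : associative quo_add.
Proof.
by elim/quo_ind=> a; elim/quo_ind=> b; elim/quo_ind=> c; rewrite !quo_addE addrA.
Qed.
Fact quo_addC : commutative quo_add.
Proof. by elim/quo_ind=> a; elim/quo_ind=> b; rewrite !quo_addE addrC. Qed.
Fact quo_add0 : left_id (quo_class 0) quo_add.
Proof. by elim/quo_ind=> a; rewrite quo_addE add0r. Qed.
Fact quo_addN : left_inverse (quo_class 0) quo_opp quo_add.
Proof. by elim/quo_ind=> a; rewrite quo_oppE quo_addE addNr. Qed.

HB.instance Definition _ :=
  GRing.isZmodule.Build quo quo_addA quo_addC quo_add0 quo_addN.

Fact quo_mulA : associative quo_mul.
Proof.
by elim/quo_ind=> a; elim/quo_ind=> b; elim/quo_ind=> c; rewrite !quo_mulE mulrA.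
Qed.
Fact quo_mulC : commutative quo_mul.
Proof. by elim/quo_ind=> a; elim/quo_ind=> b; rewrite !quo_mulE mulrC. Qed.
Fact quo_mul1 : left_id (quo_class 1) quo_mul.
Proof. by elim/quo_ind=> a; rewrite quo_mulE mul1r. Qed.
Fact quo_mulD : left_distributive quo_mul +%R.
Proof.
elim/quo_ind=> a; elim/quo_ind=> b; elim/quo_ind=> c.
by rewrite /GRing.add /= !(quo_addE, quo_mulE) mulrDl.
Qed.

HB.instance Definition _ :=
  GRing.Zmodule_isComPzRing.Build quo quo_mulA quo_mulC quo_mul1 quo_mulD.

Fact quo_class_zmod : zmod_morphism quo_class.
Proof. by move=> a b; rewrite -quo_addE -quo_oppE. Qed.
Fact quo_class_monoid : monoid_morphism quo_class.
Proof. by split=> // a b; rewrite -quo_mulE. Qed.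
HB.instance Definition _ := GRing.isZmodMorphism.Build R quo quo_class quo_class_zmod.
HB.instance Definition _ := GRing.isMonoidMorphism.Build R quo quo_class quo_class_monoid.

End Quo.

Section QuoMap.
Variables (R R' : comPzRingType) (g : {rmorphism R -> R'}) (x : R).

Definition quo_map (q : quo x) : quo (g x) := quo_class (g x) (g (quo_repr q)).

Lemma quo_mapE a : quo_map (quo_class x a) = quo_class (g x) (g a).
Proof.
apply/quo_classP; have [c e] := quo_reprP x a.
by exists (g c); rewrite -rmorphB e rmorphM.
Qed.

Fact quo_map_zmod : zmod_morphism quo_map.
Proof.
by elim/quo_ind=> a; elim/quo_ind=> b; rewrite -rmorphB !quo_mapE -rmorphB -rmorphB.
Qed.
Fact quo_map_monoid : monoid_morphism quo_map.
Proof.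
split; first by rewrite -(rmorph1 (quo_class x)) quo_mapE !rmorph1.
by elim/quo_ind=> a; elim/quo_ind=> b; rewrite -rmorphM !quo_mapE -rmorphM -rmorphM.
Qed.
HB.instance Definition _ :=
  GRing.isZmodMorphism.Build (quo x) (quo (g x)) quo_map quo_map_zmod.
HB.instance Definition _ :=
  GRing.isMonoidMorphism.Build (quo x) (quo (g x)) quo_map quo_map_monoid.

End QuoMap.

Arguments quo_map {R R'} g x _.

Section Loc.
Variables (R : comPzRingType) (x : R).

(* The pair (a, n) stands for the fraction a / x^n. *)
Definition loc_rel (u v : R * nat) : bool :=
  `[< exists k, x ^+ (k + v.2) * u.1 = x ^+ (k + u.2) * v.1 >].

Lemma loc_rel_refl : reflexive loc_rel.
Proof. by move=> u; apply/asboolP; exists 0%N. Qed.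

Lemma loc_rel_sym : symmetric loc_rel.
Proof.
suff h u v : loc_rel u v -> loc_rel v u by move=> u v; apply/idP/idP; apply: h.
by move=> /asboolP [k e]; apply/asboolP; exists k.
Qed.

Lemma loc_rel_trans : transitive loc_rel.
Proof.
move=> [b n] [a m] [c p] /asboolP /= [k e] /asboolP /= [l e'].
apply/asboolP; exists (k + l + n)%N => /=.
have -> : (k + l + n + p = (l + p) + (k + n))%N.
  by lia.
rewrite exprD -mulrA e mulrA -exprD.
have -> : (l + p + (k + m) = (k + m) + (l + p))%N by rewrite addnC.
rewrite exprD -mulrA e' mulrA -exprD; congr (x ^+ _ * _).
by rewrite -!addnA; congr addn; rewrite addnCA; congr addn; rewrite addnC.
Qed.

Canonical loc_equiv := EquivRel loc_rel loc_rel_refl loc_rel_sym loc_rel_trans.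

Definition loc : Type := {eq_quot loc_equiv}.
HB.instance Definition _ := Choice.on loc.

Definition loc_frac (a : R) (n : nat) : loc := \pi_({eq_quot loc_equiv}) (a, n).

Lemma loc_fracP a m b n :
  loc_frac a m = loc_frac b n <->
  exists k, x ^+ (k + n) * a = x ^+ (k + m) * b.
Proof. by split=> [/eqmodP/asboolP // | h]; apply/eqmodP/asboolP. Qed.

Lemma loc_ind (P : loc -> Prop) :
  (forall a n, P (loc_frac a n)) -> forall q, P q.
Proof. by move=> h; elim/quotW=> -[a n]; exact: h. Qed.

Definition loc_repr (q : loc) : R * nat := repr (q : {eq_quot loc_equiv}).

Lemma loc_reprK q : loc_frac (loc_repr q).1 (loc_repr q).2 = q.
Proof. by rewrite /loc_frac -surjective_pairing; exact: reprK. Qed.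

Definition loc_add (p q : loc) :=
  let: (a, m) := loc_repr p in let: (b, n) := loc_repr q in
  loc_frac (x ^+ n * a + x ^+ m * b) (m + n).
Definition loc_mul (p q : loc) :=
  let: (a, m) := loc_repr p in let: (b, n) := loc_repr q in
  loc_frac (a * b) (m + n).
Definition loc_opp (p : loc) :=
  let: (a, m) := loc_repr p in loc_frac (- a) m.

Lemma loc_reprP a m :
  exists k, x ^+ (k + m) * (loc_repr (loc_frac a m)).1 =
            x ^+ (k + (loc_repr (loc_frac a m)).2) * a.
Proof. by apply/loc_fracP; rewrite loc_reprK. Qed.

Lemma loc_addE a m b n :
  loc_add (loc_frac a m) (loc_frac b n) =
  loc_frac (x ^+ n * a + x ^+ m * b) (m + n).
Proof.
rewrite /loc_add; have := loc_reprP a m; have := loc_reprP b n.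
case: loc_repr => b' n' /= [k e]; case: loc_repr => a' m' /= [l e'].
apply/loc_fracP; exists (k + l)%N.
move: e e'; rewrite !exprD => e e'.
set K := x ^+ k in e *; set L := x ^+ l in e' *.
set N := x ^+ n in e *; set N' := x ^+ n' in e *.
set X := x ^+ m in e' *; set X' := x ^+ m' in e' *.
transitivity (K * N * N' * (L * X * a') + L * X * X' * (K * N * b')); first ring.
by rewrite e' e; ring.
Qed.

Lemma loc_mulE a m b n :
  loc_mul (loc_frac a m) (loc_frac b n) = loc_frac (a * b) (m + n).
Proof.
rewrite /loc_mul; have := loc_reprP a m; have := loc_reprP b n.
case: loc_repr => b' n' /= [k e]; case: loc_repr => a' m' /= [l e'].
apply/loc_fracP; exists (l + k)%N.
have -> : (l + k + (m + n) = (l + m) + (k + n))%N by rewrite addnACA.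
have -> : (l + k + (m' + n') = (l + m') + (k + n'))%N by rewrite addnACA.
by rewrite ![x ^+ (_ + _ + (_ + _))]exprD mulrACA e e' mulrACA.
Qed.

Lemma loc_oppE a m : loc_opp (loc_frac a m) = loc_frac (- a) m.
Proof.
rewrite /loc_opp; have := loc_reprP a m; case: loc_repr => a' m' /= [k e].
by apply/loc_fracP; exists k; rewrite !mulrN e.
Qed.

Lemma loc_frac_eq a m b n : a = b -> m = n -> loc_frac a m = loc_frac b n.
Proof. by move=> -> ->. Qed.

Lemma loc_frac_cancel k a n : loc_frac (x ^+ k * a) (k + n) = loc_frac a n.
Proof. by apply/loc_fracP; exists 0%N; rewrite !add0n mulrA -exprD addnC. Qed.

Fact loc_addA : associative loc_add.
Proof.
elim/loc_ind=> a m; elim/loc_ind=> b n; elim/loc_ind=> c p.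
rewrite !loc_addE; apply: loc_frac_eq; last by rewrite addnA.
rewrite !mulrDr -addrA !exprD !mulrA; congr (_ + (_ + _)).
  by rewrite (mulrC (x ^+ p)).
by rewrite (mulrC (x ^+ p)).
Qed.
Fact loc_addC : commutative loc_add.
Proof.
elim/loc_ind=> a m; elim/loc_ind=> b n; rewrite !loc_addE.
by apply: loc_frac_eq; rewrite 1?addrC 1?addnC.
Qed.
Fact loc_add0 : left_id (loc_frac 0 0) loc_add.
Proof.
elim/loc_ind=> a m; rewrite loc_addE.
by apply: loc_frac_eq; rewrite // mulr0 add0r expr0 mul1r.
Qed.
Fact loc_addN : left_inverse (loc_frac 0 0) loc_opp loc_add.
Proof.
elim/loc_ind=> a m; rewrite loc_oppE loc_addE; apply/loc_fracP; exists 0%N.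
by rewrite mulrN addNr !mulr0.
Qed.

HB.instance Definition _ :=
  GRing.isZmodule.Build loc loc_addA loc_addC loc_add0 loc_addN.

Fact loc_mulA : associative loc_mul.
Proof.
elim/loc_ind=> a m; elim/loc_ind=> b n; elim/loc_ind=> c p.
by rewrite !loc_mulE mulrA addnA.
Qed.
Fact loc_mulC : commutative loc_mul.
Proof.
by elim/loc_ind=> a m; elim/loc_ind=> b n; rewrite !loc_mulE mulrC addnC.
Qed.
Fact loc_mul1 : left_id (loc_frac 1 0) loc_mul.
Proof. by elim/loc_ind=> a m; rewrite loc_mulE mul1r. Qed.
Fact loc_mulD : left_distributive loc_mul +%R.
Proof.
elim/loc_ind=> a m; elim/loc_ind=> b n; elim/loc_ind=> c p.
rewrite /GRing.add /= !(loc_addE, loc_mulE) -(loc_frac_cancel p).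
apply: loc_frac_eq; last by lia.
by rewrite !exprD; ring.
Qed.

HB.instance Definition _ :=
  GRing.Zmodule_isComPzRing.Build loc loc_mulA loc_mulC loc_mul1 loc_mulD.

Definition loc_map (a : R) : loc := loc_frac a 0.

Fact loc_map_zmod : zmod_morphism loc_map.
Proof.
move=> a b; rewrite /GRing.add /GRing.opp /= loc_oppE loc_addE.
by apply: loc_frac_eq; rewrite // expr0 !mul1r.
Qed.
Fact loc_map_monoid : monoid_morphism loc_map.
Proof. by split=> // a b; rewrite /GRing.mul /= loc_mulE. Qed.
HB.instance Definition _ := GRing.isZmodMorphism.Build R loc loc_map loc_map_zmod.
HB.instance Definition _ := GRing.isMonoidMorphism.Build R loc loc_map loc_map_monoid.

End Loc.

Section LocFunctorial.
Variables (R R' : comPzRingType) (g : {rmorphism R -> R'}) (x : R).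

Definition loc_ind_map (q : loc x) : loc (g x) :=
  loc_frac (g x) (g (loc_repr q).1) (loc_repr q).2.

Lemma loc_ind_mapE a n : loc_ind_map (loc_frac x a n) = loc_frac (g x) (g a) n.
Proof.
apply/loc_fracP; have [k e] := loc_reprP x a n.
by exists k; rewrite -!rmorphXn -!rmorphM e.
Qed.

Fact loc_ind_map_zmod : zmod_morphism loc_ind_map.
Proof.
elim/loc_ind=> a m; elim/loc_ind=> b n; rewrite !loc_ind_mapE.
rewrite /GRing.add /GRing.opp /= !(loc_oppE, loc_addE) loc_ind_mapE.
by rewrite rmorphD !rmorphM rmorphN !rmorphXn.
Qed.
Fact loc_ind_map_monoid : monoid_morphism loc_ind_map.
Proof.
split; first by rewrite /GRing.one /= loc_ind_mapE rmorph1.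
elim/loc_ind=> a m; elim/loc_ind=> b n; rewrite !loc_ind_mapE.
by rewrite /GRing.mul /= !loc_mulE loc_ind_mapE rmorphM.
Qed.
HB.instance Definition _ :=
  GRing.isZmodMorphism.Build (loc x) (loc (g x)) loc_ind_map loc_ind_map_zmod.
HB.instance Definition _ :=
  GRing.isMonoidMorphism.Build (loc x) (loc (g x)) loc_ind_map loc_ind_map_monoid.

End LocFunctorial.

Arguments loc_ind_map {R R'} g x _.

Section ModuleProperties.
Variables (R : comPzRingType) (M : lmodType R).

Definition mod_fin_gen : Prop :=
  exists n (e : 'I_n -> M), forall m, exists c : 'I_n -> R,
    m = \sum_(i < n) c i *: e i.

Definition mod_projective : Prop :=
  forall (N P : lmodType R) (p : {linear N -> P}) (f : {linear M -> P}),
    (forall y, exists z, p z = y) ->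
    exists h : {linear M -> N}, forall m, p (h m) = f m.

Definition fg_projective : Prop := mod_fin_gen /\ mod_projective.

End ModuleProperties.

Arguments mod_fin_gen {R} M.
Arguments mod_projective {R} M.
Arguments fg_projective {R} M.

Section LinearMaps.
Variable R : comPzRingType.

Lemma lin_ext (U V : lmodType R) (f g : {linear U -> V}) : f =1 g -> f = g.
Proof.
case: f => f [[fa] [fs]]; case: g => g [[ga] [gs]] /= /funext e.
move: ga gs; rewrite -e => ga gs.
by rewrite (Prop_irrelevance ga fa) (Prop_irrelevance gs fs).
Qed.

Definition lin_id (U : lmodType R) : {linear U -> U} := idfun.

Definition lin_comp (U V W : lmodType R) (g : {linear V -> W})
  (f : {linear U -> V}) : {linear U -> W} := g \o f.

End LinearMaps.

(* Restriction of scalars along f; see [restr_scaleE]. *)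
Definition restr (R A : comPzRingType) (f : {rmorphism R -> A})
  (M : lmodType A) : Type := M.

Section Restriction.
Variables (R A : comPzRingType) (f : {rmorphism R -> A}) (M : lmodType A).
Local Notation restr := (restr f M).

HB.instance Definition _ := GRing.Zmodule.on restr.

Definition restr_scale (r : R) (m : restr) : restr := (f r *: (m : M)).

Fact restr_scaleA r s m :
  restr_scale r (restr_scale s m) = restr_scale (r * s) m.
Proof. by rewrite /restr_scale scalerA rmorphM. Qed.
Fact restr_scale1 : left_id 1 restr_scale.
Proof. by move=> m; rewrite /restr_scale rmorph1 scale1r. Qed.
Fact restr_scaleDr : right_distributive restr_scale +%R.
Proof. by move=> r m n; rewrite /restr_scale scalerDr. Qed.
Fact restr_scaleDl m : {morph restr_scale^~ m : r s / r + s}.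
Proof. by move=> r s; rewrite /restr_scale rmorphD scalerDl. Qed.

HB.instance Definition _ := GRing.Zmodule_isLmodule.Build R restr
  restr_scaleA restr_scale1 restr_scaleDr restr_scaleDl.

Lemma restr_scaleE (r : R) (m : restr) : r *: m = (f r *: (m : M)).
Proof. by []. Qed.

End Restriction.

Section BaseChange.
Variables (R S : comPzRingType) (f : {rmorphism R -> S}) (M : lmodType R).

(* The sequence [:: (m1, s1); ...; (mn, sn)] stands for the formal sum of the
   mi (x) si.  No formal negatives are needed, as - (m (x) s) = (- m) (x) s. *)
Inductive tens_cong : seq (M * S) -> seq (M * S) -> Prop :=
| tens_refl u : tens_cong u u
| tens_sym u v : tens_cong u v -> tens_cong v u
| tens_trans u v w : tens_cong u v -> tens_cong v w -> tens_cong u w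
| tens_cat u u' v v' :
    tens_cong u u' -> tens_cong v v' -> tens_cong (u ++ v) (u' ++ v')
| tens_catC u v : tens_cong (u ++ v) (v ++ u)
| tens_0l s : tens_cong [:: (0, s)] [::]
| tens_Dl m m' s : tens_cong [:: (m + m', s)] [:: (m, s); (m', s)]
| tens_Dr m s s' : tens_cong [:: (m, s + s')] [:: (m, s); (m, s')]
| tens_Z r m s : tens_cong [:: (r *: m, s)] [:: (m, f r * s)].

Definition tens_rel u v : bool := `[< tens_cong u v >].

Lemma tens_rel_refl : reflexive tens_rel.
Proof. by move=> u; apply/asboolP; exact: tens_refl. Qed.
Lemma tens_rel_sym : symmetric tens_rel.
Proof. by move=> u v; apply/asboolP/asboolP; exact: tens_sym. Qed.
Lemma tens_rel_trans : transitive tens_rel.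
Proof.
by move=> v u w /asboolP h /asboolP h'; apply/asboolP; exact: tens_trans h h'.
Qed.

Canonical tens_equiv :=
  EquivRel tens_rel tens_rel_refl tens_rel_sym tens_rel_trans.

Definition bc : Type := {eq_quot tens_equiv}.
HB.instance Definition _ := Choice.on bc.

Definition bc_class (u : seq (M * S)) : bc := \pi_({eq_quot tens_equiv}) u.

Definition tens (m : M) (s : S) : bc := bc_class [:: (m, s)].

Lemma bc_classP u v : bc_class u = bc_class v <-> tens_cong u v.
Proof. by split=> [/eqmodP/asboolP // | h]; apply/eqmodP/asboolP. Qed.

Definition bc_repr (t : bc) : seq (M * S) := repr (t : {eq_quot tens_equiv}).

Lemma bc_reprK t : bc_class (bc_repr t) = t.
Proof. exact: reprK. Qed.

Lemma bc_reprP u : tens_cong (bc_repr (bc_class u)) u.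
Proof. by apply/bc_classP; rewrite bc_reprK. Qed.

Lemma bc_class_ind (P : bc -> Prop) :
  (forall u, P (bc_class u)) -> forall t, P t.
Proof. by move=> h t; rewrite -(bc_reprK t). Qed.

Definition bc_add (t u : bc) := bc_class (bc_repr t ++ bc_repr u).
Definition tens_opp (u : seq (M * S)) := [seq (- p.1, p.2) | p <- u].
Definition bc_opp (t : bc) := bc_class (tens_opp (bc_repr t)).
Definition tens_scale (a : S) (u : seq (M * S)) := [seq (p.1, a * p.2) | p <- u].
Definition bc_scale (a : S) (t : bc) := bc_class (tens_scale a (bc_repr t)).

Lemma bc_addE u v : bc_add (bc_class u) (bc_class v) = bc_class (u ++ v).
Proof. by apply/bc_classP; apply: tens_cat; exact: bc_reprP. Qed.

Lemma tens_opp_cong u v : tens_cong u v -> tens_cong (tens_opp u) (tens_opp v).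
Proof.
elim=> {u v}.
- by move=> u; exact: tens_refl.
- by move=> u v _; exact: tens_sym.
- by move=> u v w _ h _ h'; exact: tens_trans h h'.
- by move=> u u' v v' _ h _ h'; rewrite /tens_opp !map_cat; exact: tens_cat.
- by move=> u v; rewrite /tens_opp !map_cat; exact: tens_catC.
- by move=> s /=; rewrite oppr0; exact: tens_0l.
- by move=> m m' s /=; rewrite opprD; exact: tens_Dl.
- by move=> m s s' /=; exact: tens_Dr.
- by move=> r m s /=; rewrite -scalerN; exact: tens_Z.
Qed.

Lemma bc_oppE u : bc_opp (bc_class u) = bc_class (tens_opp u).
Proof. by apply/bc_classP; apply: tens_opp_cong; exact: bc_reprP. Qed.

Lemma tens_scale_cong a u v :
  tens_cong u v -> tens_cong (tens_scale a u) (tens_scale a v).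
Proof.
elim=> {u v}.
- by move=> u; exact: tens_refl.
- by move=> u v _; exact: tens_sym.
- by move=> u v w _ h _ h'; exact: tens_trans h h'.
- by move=> u u' v v' _ h _ h'; rewrite /tens_scale !map_cat; exact: tens_cat.
- by move=> u v; rewrite /tens_scale !map_cat; exact: tens_catC.
- by move=> s /=; exact: tens_0l.
- by move=> m m' s /=; exact: tens_Dl.
- by move=> m s s' /=; rewrite mulrDr; exact: tens_Dr.
- by move=> r m s /=; rewrite mulrCA; exact: tens_Z.
Qed.

Lemma bc_scaleE a u : bc_scale a (bc_class u) = bc_class (tens_scale a u).
Proof. by apply/bc_classP; apply: tens_scale_cong; exact: bc_reprP. Qed.

Lemma tens_opp_cancel u : tens_cong (tens_opp u ++ u) [::].
Proof.
elim: u => [|[m s] u ih] /=; first exact: tens_refl.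
have move_b : tens_cong (tens_opp u ++ (m, s) :: u) ([:: (m, s)] ++ (tens_opp u ++ u)).
  rewrite -[(m, s) :: u]cat1s !catA.
  by apply: tens_cat; [exact: tens_catC|exact: tens_refl].
have h := tens_cat (tens_refl [:: (- m, s)]) move_b.
apply: tens_trans h _; rewrite catA.
apply: (@tens_cat _ [::] _ [::]) => //=.
apply: tens_trans (tens_0l s); rewrite -(addNr m).
by apply: tens_sym; exact: tens_Dl.
Qed.

Fact bc_addA : associative bc_add.
Proof.
elim/bc_class_ind=> u; elim/bc_class_ind=> v; elim/bc_class_ind=> w.
by rewrite !bc_addE catA.
Qed.
Fact bc_addC : commutative bc_add.
Proof.
elim/bc_class_ind=> u; elim/bc_class_ind=> v; rewrite !bc_addE.
by apply/bc_classP; exact: tens_catC.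
Qed.
Fact bc_add0 : left_id (bc_class [::]) bc_add.
Proof. by elim/bc_class_ind=> u; rewrite bc_addE. Qed.
Fact bc_addN : left_inverse (bc_class [::]) bc_opp bc_add.
Proof.
elim/bc_class_ind=> u; rewrite bc_oppE bc_addE.
by apply/bc_classP; exact: tens_opp_cancel.
Qed.

HB.instance Definition _ :=
  GRing.isZmodule.Build bc bc_addA bc_addC bc_add0 bc_addN.

Lemma bc_class_cat u v : bc_class (u ++ v) = bc_class u + bc_class v.
Proof. by rewrite -bc_addE. Qed.

Lemma bc_class_sum u : bc_class u = \sum_(p <- u) tens p.1 p.2.
Proof.
elim: u => [|[m s] u ih]; first by rewrite big_nil.
by rewrite big_cons -ih -bc_class_cat.
Qed.

Fact bc_scaleA a b t : bc_scale a (bc_scale b t) = bc_scale (a * b) t.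
Proof.
elim/bc_class_ind: t => u; rewrite !bc_scaleE /tens_scale -map_comp.
by congr bc_class; apply: eq_map => p /=; rewrite mulrA.
Qed.
Fact bc_scale1 : left_id 1 bc_scale.
Proof.
elim/bc_class_ind=> u; rewrite bc_scaleE; congr bc_class.
by rewrite -[RHS]map_id; apply: eq_map => -[m s] /=; rewrite mul1r.
Qed.
Fact bc_scaleDr : right_distributive bc_scale +%R.
Proof.
move=> a; elim/bc_class_ind=> u; elim/bc_class_ind=> v.
by rewrite -bc_class_cat !bc_scaleE -bc_class_cat /tens_scale map_cat.
Qed.
Fact bc_scaleDl t : {morph bc_scale^~ t : a b / a + b}.
Proof.
elim/bc_class_ind: t => u a b; rewrite !bc_scaleE !bc_class_sum !big_map.
rewrite -big_split /=; apply: eq_bigr => -[m s] _ /=.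
by rewrite /tens -bc_class_cat; apply/bc_classP; rewrite mulrDl; exact: tens_Dr.
Qed.

HB.instance Definition _ := GRing.Zmodule_isLmodule.Build S bc
  bc_scaleA bc_scale1 bc_scaleDr bc_scaleDl.

Lemma tensDl m m' s : tens (m + m') s = tens m s + tens m' s.
Proof. by rewrite /tens -bc_class_cat; apply/bc_classP; exact: tens_Dl. Qed.
Lemma tensDr m s s' : tens m (s + s') = tens m s + tens m s'.
Proof. by rewrite /tens -bc_class_cat; apply/bc_classP; exact: tens_Dr. Qed.
Lemma tensZ r m s : tens (r *: m) s = tens m (f r * s).
Proof. by apply/bc_classP; exact: tens_Z. Qed.
Lemma scale_tens a m s : a *: tens m s = tens m (a * s).
Proof. by rewrite /GRing.scale /= bc_scaleE. Qed.

(* The unit m |-> m (x) 1. *)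
Definition bc_unit_fun (m : M) : restr f bc := tens m 1.

Fact bc_unit_linear : linear bc_unit_fun.
Proof.
move=> r m m'; rewrite /bc_unit_fun tensDl tensZ; congr (_ + _).
by rewrite restr_scaleE scale_tens.
Qed.
HB.instance Definition _ :=
  GRing.isLinear.Build R M (restr f bc) *:%R bc_unit_fun bc_unit_linear.

Definition bc_unit : {linear M -> restr f bc} := bc_unit_fun.

Lemma bc_ind (P : bc -> Prop) :
  (forall m, P (tens m 1)) -> (forall a t, P t -> P (a *: t)) ->
  (forall t u, P t -> P u -> P (t + u)) -> forall t, P t.
Proof.
move=> P1 PZ PD; elim/bc_class_ind; elim=> [|[m s] u ih].
  by have := PZ 0 _ (P1 0); rewrite scale0r.
rewrite bc_class_sum big_cons -bc_class_sum; apply: PD => //=.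
by rewrite -(mulr1 s) -scale_tens; apply: PZ.
Qed.

End BaseChange.

Section BaseChangeLift.
Variables (R S : comPzRingType) (f : {rmorphism R -> S}).
Variables (M : lmodType R) (N : lmodType S) (phi : {linear M -> restr f N}).

(* The S-linear extension m (x) s |-> s * phi m of phi. *)
Definition bc_lift_fun (t : bc f M) : N :=
  \sum_(p <- bc_repr t) p.2 *: (phi p.1 : N).

Lemma bc_lift_cong u v : tens_cong f u v ->
  \sum_(p <- u) p.2 *: (phi p.1 : N) = \sum_(p <- v) p.2 *: (phi p.1 : N).
Proof.
elim=> {u v}.
- by [].
- by [].
- by move=> u v w _ -> _ ->.
- by move=> u u' v v' _ h _ h'; rewrite !big_cat /= h h'.
- by move=> u v; rewrite !big_cat /= addrC.
- by move=> s; rewrite big_seq1 big_nil linear0 scaler0.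
- by move=> m m' s; rewrite big_seq1 !big_cons big_nil addr0 /= linearD scalerDr.
- by move=> m s s'; rewrite big_seq1 !big_cons big_nil addr0 /= scalerDl.
- by move=> r m s; rewrite !big_seq1 /= linearZ_LR restr_scaleE scalerA mulrC.
Qed.

Lemma bc_lift_class u :
  bc_lift_fun (bc_class f u) = \sum_(p <- u) p.2 *: (phi p.1 : N).
Proof. by apply: bc_lift_cong; exact: bc_reprP. Qed.

Fact bc_lift_linear : linear bc_lift_fun.
Proof.
move=> a; elim/bc_class_ind=> u; elim/bc_class_ind=> v.
rewrite [a *: _]bc_scaleE -bc_class_cat !bc_lift_class big_cat /=.
congr (_ + _); rewrite big_map scaler_sumr.
by apply: eq_bigr => p _ /=; rewrite scalerA.
Qed.
HB.instance Definition _ :=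
  GRing.isLinear.Build S (bc f M) N *:%R bc_lift_fun bc_lift_linear.

Definition bc_lift : {linear bc f M -> N} := bc_lift_fun.

Lemma bc_liftE m s : bc_lift (tens f m s) = s *: (phi m : N).
Proof. by rewrite /= bc_lift_class big_seq1. Qed.

End BaseChangeLift.

Lemma bc_lin_ext (R S : comPzRingType) (f : {rmorphism R -> S})
  (M : lmodType R) (N : lmodType S) (u v : {linear bc f M -> N}) :
  (forall m, u (tens f m 1) = v (tens f m 1)) -> u =1 v.
Proof.
move=> h; elim/bc_ind=> // [a t e|t t' e e']; first by rewrite !linearZ /= e.
by rewrite !linearD e e'.
Qed.

Section RestrictionMap.
Variables (R A : comPzRingType) (f : {rmorphism R -> A}) (M N : lmodType A).
Variable phi : {linear M -> N}.
Definition restr_map_fun (m : restr f M) : restr f N := phi m.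
Fact restr_map_linear : linear restr_map_fun.
Proof. by move=> r m n; rewrite /restr_map_fun restr_scaleE linearP. Qed.
HB.instance Definition _ := GRing.isLinear.Build R (restr f M) (restr f N)
  *:%R restr_map_fun restr_map_linear.
Definition restr_map : {linear restr f M -> restr f N} := restr_map_fun.
End RestrictionMap.

(* phi (x) 1 *)
Definition bc_map (R S : comPzRingType) (f : {rmorphism R -> S})
  (M N : lmodType R) (phi : {linear M -> N}) : {linear bc f M -> bc f N} :=
  bc_lift (lin_comp (bc_unit f N) phi).

Lemma bc_mapE (R S : comPzRingType) (f : {rmorphism R -> S})
  (M N : lmodType R) (phi : {linear M -> N}) m s :
  bc_map f phi (tens f m s) = tens f (phi m) s.
Proof. by rewrite bc_liftE /= scale_tens mulr1. Qed.

Section BaseChangeComp.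
Variables (R A S : comPzRingType).
Variables (g : {rmorphism R -> A}) (h : {rmorphism A -> S}).
Variables (k : {rmorphism R -> S}) (kE : forall r, k r = h (g r)).
Variable M : lmodType R.

Definition bc_comp_unit (m : M) : restr g (restr h (bc k M)) := tens k m 1.
Fact bc_comp_unit_linear : linear bc_comp_unit.
Proof.
move=> r m m'; rewrite /bc_comp_unit tensDl tensZ; congr (_ + _).
by rewrite !restr_scaleE scale_tens kE.
Qed.
HB.instance Definition _ := GRing.isLinear.Build R M
  (restr g (restr h (bc k M))) *:%R bc_comp_unit bc_comp_unit_linear.

Definition bc_comp : {linear bc h (bc g M) -> bc k M} :=
  bc_lift (bc_lift (bc_comp_unit : {linear M -> restr g (restr h (bc k M))})).

Lemma bc_compE m a s :
  bc_comp (tens h (tens g m a) s) = tens k m (h a * s).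
Proof.
rewrite bc_liftE bc_liftE restr_scaleE /= !scale_tens mulr1.
by rewrite mulrC.
Qed.

Definition bc_uncomp_unit (m : M) : restr k (bc h (bc g M)) :=
  tens h (tens g m 1) 1.
Fact bc_uncomp_unit_linear : linear bc_uncomp_unit.
Proof.
move=> r m m'; rewrite /bc_uncomp_unit !tensDl tensZ; congr (_ + _).
by rewrite -scale_tens tensZ restr_scaleE scale_tens kE.
Qed.
HB.instance Definition _ := GRing.isLinear.Build R M
  (restr k (bc h (bc g M))) *:%R bc_uncomp_unit bc_uncomp_unit_linear.

Definition bc_uncomp : {linear bc k M -> bc h (bc g M)} :=
  bc_lift (bc_uncomp_unit : {linear M -> restr k (bc h (bc g M))}).

Lemma bc_uncompE m s :
  bc_uncomp (tens k m s) = tens h (tens g m 1) s.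
Proof. by rewrite bc_liftE /= scale_tens mulr1. Qed.

Lemma bc_compK : cancel bc_comp bc_uncomp.
Proof.
elim/bc_ind=> [t|s t e|t u e e'].
- elim/bc_ind: t => [m|a t e|t u e e'].
  + by rewrite bc_compE bc_uncompE rmorph1 mul1r.
  + by rewrite tensZ -scale_tens !linearZ /= e.
  + by rewrite tensDl !linearD e e'.
- by rewrite !linearZ /= e.
- by rewrite !linearD e e'.
Qed.

Lemma bc_uncompK : cancel bc_uncomp bc_comp.
Proof.
elim/bc_ind=> [m|s t e|t u e e'].
- by rewrite bc_uncompE bc_compE rmorph1 mul1r.
- by rewrite !linearZ /= e.
- by rewrite !linearD e e'.
Qed.

End BaseChangeComp.

Record category := Category {
  ob :> Type;
  hom : ob -> ob -> Type;
  idm : forall a, hom a a;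
  comp : forall a b c, hom b c -> hom a b -> hom a c;
  comp1m : forall a b (f : hom a b), comp (idm b) f = f;
  compm1 : forall a b (f : hom a b), comp f (idm a) = f;
  compA : forall a b c d (f : hom a b) (g : hom b c) (h : hom c d),
    comp h (comp g f) = comp (comp h g) f }.

Arguments hom {_} _ _.
Arguments idm {_} a.
Arguments comp {_ _ _ _} _ _.

Record functor (C D : category) := Functor {
  fob :> C -> D;
  fmor : forall a b : C, hom a b -> hom (fob a) (fob b);
  fmor1 : forall a : C, fmor (idm a) = idm (fob a);
  fmorM : forall (a b c : C) (g : hom b c) (f : hom a b),
    fmor (comp g f) = comp (fmor g) (fmor f) }.

Arguments fmor {_ _} _ {_ _} _.

Definition functor_id (C : category) : functor C C.
Proof. by exists (fun a => a) (fun a b f => f). Defined.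

Definition functor_comp (C D E : category) (G : functor D E) (F : functor C D) :
  functor C E.
Proof.
exists (fun a => G (F a)) (fun a b f => fmor G (fmor F f)).
- by move=> a; rewrite !fmor1.
- by move=> a b c g f; rewrite !fmorM.
Defined.

Record nat_iso (C D : category) (F G : functor C D) := NatIso {
  nat_fwd : forall a : C, hom (F a) (G a);
  nat_bwd : forall a : C, hom (G a) (F a);
  nat_fwdK : forall a, comp (nat_bwd a) (nat_fwd a) = idm (F a);
  nat_bwdK : forall a, comp (nat_fwd a) (nat_bwd a) = idm (G a);
  nat_natural : forall (a b : C) (f : hom a b),
    comp (fmor G f) (nat_fwd a) = comp (nat_fwd b) (fmor F f) }.

Definition full_subcategory (C : category) (P : C -> Prop) : category.
Proof.
exists {a : C | P a} (fun a b => hom (sval a) (sval b)) (fun a => idm (sval a))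
  (fun a b c g f => comp g f).
- by move=> a b f; rewrite comp1m.
- by move=> a b f; rewrite compm1.
- by move=> a b c d f g h; rewrite compA.
Defined.

Definition functor_restrict (C D : category) (P : C -> Prop) (Q : D -> Prop)
  (F : functor C D) (PQ : forall a, P a -> Q (F a)) :
  functor (full_subcategory P) (full_subcategory Q).
Proof.
exists (fun a : full_subcategory P =>
          exist Q (F (sval a)) (PQ _ (svalP a)) : full_subcategory Q)
       (fun a b (f : hom (sval a) (sval b)) => fmor F f).
- by move=> a; rewrite /= fmor1.
- by move=> a b c g f; rewrite /= fmorM.
Defined.

(* That F and G preserve P and Q is part of the claim. *)
Definition induce_inverse_equivalences (C D : category) (P : C -> Prop)
  (Q : D -> Prop) (F : functor C D) (G : functor D C) : Prop :=
  exists (PQ : forall a, P a -> Q (F a)) (QP : forall b, Q b -> P (G b)),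
    let F' := functor_restrict PQ in let G' := functor_restrict QP in
    inhabited (nat_iso (functor_comp G' F') (functor_id _)) /\
    inhabited (nat_iso (functor_comp F' G') (functor_id _)).

Definition Mod (R : comPzRingType) : category.
Proof.
exists (lmodType R) (fun U V : lmodType R => {linear U -> V}) (@lin_id R) (@lin_comp R).
- by move=> U V f; exact: lin_ext.
- by move=> U V f; exact: lin_ext.
- by move=> U V W X f g h; exact: lin_ext.
Defined.

Record square := Square {
  sqR : comPzRingType; sq1 : comPzRingType;
  sq2 : comPzRingType; sqS : comPzRingType;
  sg1 : {rmorphism sqR -> sq1}; sg2 : {rmorphism sqR -> sq2};
  sh1 : {rmorphism sq1 -> sqS}; sh2 : {rmorphism sq2 -> sqS};
  sqE : forall r, sh1 (sg1 r) = sh2 (sg2 r) }.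

Section Patching.
Variable sq : square.
Local Notation R := (sqR sq).
Local Notation R1 := (sq1 sq).
Local Notation R2 := (sq2 sq).
Local Notation S := (sqS sq).
Local Notation g1 := (sg1 sq).
Local Notation g2 := (sg2 sq).
Local Notation h1 := (sh1 sq).
Local Notation h2 := (sh2 sq).

Record patching_datum := PatchingDatum {
  pd1 : lmodType R1;
  pd2 : lmodType R2;
  pd_iso : {linear bc h1 pd1 -> bc h2 pd2};
  pd_bij : bijective pd_iso }.

Record pd_hom (X Y : patching_datum) := PdHom {
  pd_hom1 : {linear pd1 X -> pd1 Y};
  pd_hom2 : {linear pd2 X -> pd2 Y};
  pd_homE : forall t,
    pd_iso Y (bc_map h1 pd_hom1 t) = bc_map h2 pd_hom2 (pd_iso X t) }.

Lemma pd_hom_ext X Y (f g : pd_hom X Y) :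
  pd_hom1 f =1 pd_hom1 g -> pd_hom2 f =1 pd_hom2 g -> f = g.
Proof.
case: f => f1 f2 fE; case: g => k1 k2 kE /= /lin_ext e1 /lin_ext e2.
by case: _ / e1 in kE *; case: _ / e2 in kE *; congr PdHom; exact: Prop_irrelevance.
Qed.

Lemma bc_map_id (A B : comPzRingType) (f : {rmorphism A -> B}) (M : lmodType A) :
  bc_map f (lin_id M) =1 id.
Proof. by apply: (bc_lin_ext (v := lin_id _)) => m; rewrite bc_mapE. Qed.

Lemma bc_map_comp (A B : comPzRingType) (f : {rmorphism A -> B})
  (M N P : lmodType A) (v : {linear N -> P}) (u : {linear M -> N}) :
  bc_map f (lin_comp v u) =1 bc_map f v \o bc_map f u.
Proof.
apply: (bc_lin_ext (v := lin_comp (bc_map f v) (bc_map f u))) => m.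
by rewrite /= !bc_mapE.
Qed.

Definition pd_id X : pd_hom X X.
Proof. by exists (lin_id _) (lin_id _) => t; rewrite !bc_map_id. Defined.

Definition pd_comp X Y Z (g : pd_hom Y Z) (f : pd_hom X Y) : pd_hom X Z.
Proof.
exists (lin_comp (pd_hom1 g) (pd_hom1 f)) (lin_comp (pd_hom2 g) (pd_hom2 f)).
by move=> t; rewrite !bc_map_comp /= !pd_homE.
Defined.

Definition PD : category.
Proof.
exists patching_datum pd_hom pd_id pd_comp.
- by move=> X Y f; exact: pd_hom_ext.
- by move=> X Y f; exact: pd_hom_ext.
- by move=> X Y Z W f g h; exact: pd_hom_ext.
Defined.

Definition pd_fg_projective (X : patching_datum) : Prop :=
  fg_projective (pd1 X) /\ fg_projective (pd2 X).

(* M (x)_R S, with S an R-algebra through the square *)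
Definition sqk : {rmorphism R -> S} := h1 \o g1.

Lemma sqk1 r : sqk r = h1 (g1 r). Proof. by []. Qed.
Lemma sqk2 r : sqk r = h2 (g2 r). Proof. exact: sqE. Qed.

(* The identity of M (x)_R S, read through the canonical isomorphisms
   (M (x)_R Ri) (x)_Ri S = M (x)_R S. *)
Definition base_iso (M : lmodType R) :
  {linear bc h1 (bc g1 M) -> bc h2 (bc g2 M)} :=
  lin_comp (bc_uncomp sqk2 M) (bc_comp sqk1 M).

Lemma base_isoE M m : base_iso M (tens h1 (tens g1 m 1) 1) =
  tens h2 (tens g2 m 1) 1.
Proof. by rewrite /base_iso [LHS]/= bc_compE rmorph1 mul1r bc_uncompE. Qed.

Lemma base_iso_bij M : bijective (base_iso M).
Proof.
have b1 := Bijective (bc_compK sqk1 (M := M)) (bc_uncompK sqk1 (M := M)).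
have b2 := Bijective (bc_uncompK sqk2 (M := M)) (bc_compK sqk2 (M := M)).
exact: bij_comp b2 b1.
Qed.

Definition F_ob (M : lmodType R) : patching_datum :=
  PatchingDatum (base_iso_bij M).

Definition F_mor (M N : lmodType R) (f : {linear M -> N}) :
  pd_hom (F_ob M) (F_ob N).
Proof.
exists (bc_map g1 f) (bc_map g2 f) => t.
elim/bc_ind: t => [t|s t e|t u e e'].
- elim/bc_ind: t => [m|a t e|t u e e'].
  + by rewrite bc_mapE bc_mapE [LHS]base_isoE [in RHS]base_isoE !bc_mapE.
  + by rewrite tensZ -scale_tens !linearZ e.
  + by rewrite tensDl !linearD e e'.
- by rewrite !linearZ e.
- by rewrite !linearD e e'.
Defined.

Definition F_functor : functor (Mod R) PD.
Proof.
exists (F_ob : Mod R -> PD) F_mor.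
- by move=> M; apply: pd_hom_ext; exact: bc_map_id.
- by move=> M N P g f; apply: pd_hom_ext; exact: bc_map_comp.
Defined.

Section Glue.
Variable X : patching_datum.

Definition glue_pred : {pred (restr g1 (pd1 X) * restr g2 (pd2 X))%type} :=
  fun p => `[< pd_iso X (tens h1 (p.1 : pd1 X) 1) = tens h2 (p.2 : pd2 X) 1 >].

Record glue := Glue {
  glue_val : (restr g1 (pd1 X) * restr g2 (pd2 X))%type;
  glue_valP : glue_val \in glue_pred }.

HB.instance Definition _ := [isSub for glue_val].
HB.instance Definition _ := [Choice of glue by <:].

Fact glue_submod_closed : submod_closed glue_pred.
Proof.
split=> [|r p q].
  apply/asboolP => /=; rewrite -[X in tens _ X _](scale0r 0) tensZ.
  by rewrite -[X in _ = tens _ X _](scale0r 0) tensZ !rmorph0 !mul0r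
    -(mul0r 1) -!scale_tens !scale0r linear0.
move=> /asboolP ep /asboolP eq; apply/asboolP => /=.
rewrite !tensDl linearD eq !restr_scaleE !tensZ -!scale_tens linearZ /= ep.
by rewrite sqE.
Qed.
HB.instance Definition _ :=
  GRing.isSubmodClosed.Build R _ glue_pred glue_submod_closed.
HB.instance Definition _ := [SubChoice_isSubLmodule of glue by <:].

Lemma glueP (z : glue) :
  pd_iso X (tens h1 ((val z).1 : pd1 X) 1) = tens h2 ((val z).2 : pd2 X) 1.
Proof. exact/asboolP/(valP z). Qed.

End Glue.

Section GlueMap.
Variables (X Y : patching_datum) (f : pd_hom X Y).

Definition glue_map_val (z : glue X) :
  (restr g1 (pd1 Y) * restr g2 (pd2 Y))%type :=
  (restr_map g1 (pd_hom1 f) (val z).1, restr_map g2 (pd_hom2 f) (val z).2).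

Fact glue_map_subproof z : glue_map_val z \in @glue_pred Y.
Proof. by apply/asboolP => /=; rewrite -!bc_mapE pd_homE glueP. Qed.

Definition glue_map_fun (z : glue X) : glue Y := Glue (glue_map_subproof z).

Fact glue_map_linear : linear glue_map_fun.
Proof. by move=> r z w; apply: val_inj; rewrite /= /glue_map_val !linearP. Qed.
HB.instance Definition _ := GRing.isLinear.Build R (glue X) (glue Y) *:%R
  glue_map_fun glue_map_linear.

Definition glue_map : {linear glue X -> glue Y} := glue_map_fun.

End GlueMap.

Definition G_functor : functor PD (Mod R).
Proof.
exists ((fun X => glue X) : PD -> Mod R) glue_map.
- by move=> X; apply: lin_ext => -[[a b] p]; exact: val_inj.
- by move=> X Y Z g f; apply: lin_ext => z; exact: val_inj.
Defined.

Definition milnor_patching_diagram : Prop :=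
  induce_inverse_equivalences (fun M : Mod R => fg_projective M)
    (fun X : PD => pd_fg_projective X) F_functor G_functor.

End Patching.

Section LocalizationSquare.
Variables (R R' : comPzRingType) (g : {rmorphism R -> R'}) (x : R).

Lemma loc_squareE r : loc_ind_map g x (loc_map x r) = loc_map (g x) (g r).
Proof. exact: loc_ind_mapE. Qed.

Definition loc_square : square :=
  @Square R (loc x) R' (loc (g x)) (loc_map x) g (loc_ind_map g x)
    (loc_map (g x)) loc_squareE.

End LocalizationSquare.

(* A is a domain and, up to an isomorphism of K with its fraction field, i is
   the standard inclusion. *)
Definition is_fraction_field (A K : comPzRingType) (i : {rmorphism A -> K}) :
  Prop :=
  exists (D : idomainType) (u : {rmorphism A -> D})
    (v : {rmorphism K -> {fraction D}}),
    [/\ bijective u, bijective v & forall a, v (i a) = tofrac (u a)].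

(* Main.v *)
From HB Require Import structures.
From mathcomp Require Import all_boot all_algebra.
From mathcomp Require Import fraction zify ring.
From mathcomp Require Import boolp classical_sets.
Require Import Defs.

(* Write x' = g(x), A = R/(x), B = R'/(x').

   If the square patches, then R is the pullback of R_x and R', so A -> B is
   injective.  For b in R', glue R_x^2 and R'^2 along [[1, b/x'], [0, 1]]: the
   result is N = {(s, q) in R^2 : s + b q in x'R'}, which contains (x, 0) and
   (0, x).  If neither b nor 1/b comes from A, then N lies in M + M, so that,
   as x is not in M^2, these two elements are independent modulo M N; N being
   projective, this forces N = x R^2, which does not generate R'^2.  So each
   element of B is in A or is the inverse of one.  If A <> B it follows that A
   is a discrete valuation ring with fraction field B, whence R is regular of
   dimension 2.

   Conversely, let N be the glueing of M1 and M2.  It embeds in some R^k, hence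
   is finitely generated, and N/xN embeds in M2/x'M2.  A minimal generating
   family of N is independent modulo x: when A = B because M2 is projective, and
   when A is a discrete valuation ring because N/xN is torsion-free.  So N is
   free, and the cokernel of R' (x) N -> M2 vanishes, being both x'-power torsion
   and x'-torsion-free. *)

Set Implicit Arguments.
Unset Strict Implicit.
Unset Printing Implicit Defensive.

Import GRing.Theory.
Local Open Scope classical_set_scope.
Local Open Scope ring_scope.

(** * Submodules and local rings *)

(** The matrix [[1, b/x'], [0, 1]] is chosen because its glueing has an evident basis exactly in the
    good cases: (-c, 1), (x, 0) if b = g(c) modulo x', and (1, -c), (0, x) if g(c) b = 1 modulo x'.
    In both cases a basis vector has a unit coordinate, and that is what is lost when N lies in M +
    M. The hypothesis only provides some natural isomorphisms, not the canonical ones. Necessity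
    therefore relies on consequences that do not depend on their choice: N is projective, its second
    projections generate M2, and the fibre product of R_x and R' is isomorphic to R as a module.
    Projective modules enter through dual bases. Coordinate forms extend to base changes and decide
    equalities there, in place of flatness arguments. Dimension 2 is computed by hand: a prime not
    containing M is principal, and nonzero principal primes of a domain are never strictly
    nested. *)

Definition submod (R : comPzRingType) (V : lmodType R) (P : V -> Prop) : Prop :=
  [/\ P 0, forall u v, P u -> P v -> P (u + v) & forall a u, P u -> P (a *: u)].

Section Submodules.
Variables (R : comPzRingType) (V : lmodType R) (P : V -> Prop).
Hypothesis Psub : submod P.

Lemma submodN u : P u -> P (- u).
Proof. by case: Psub => _ _ h /(h (-1)); rewrite scaleN1r. Qed.

Lemma submodB u v : P u -> P v -> P (u - v).
Proof. by move=> hu /submodN; case: Psub => _ h _; exact: h. Qed.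

Lemma submod_sum n (F : 'I_n -> V) : (forall i, P (F i)) -> P (\sum_i F i).
Proof. by move=> h; case: Psub => P0 PD _; elim/big_ind: _. Qed.

Lemma submod_comb n (a : 'I_n -> R) (F : 'I_n -> V) :
  (forall i, P (F i)) -> P (\sum_i a i *: F i).
Proof. by move=> h; apply: submod_sum => i; case: Psub => _ _ PZ; exact: PZ. Qed.

Lemma submod_subr u v : P (u - v) -> P v -> P u.
Proof. by move=> h hv; rewrite -(subrK v u); case: Psub => _ PD _; exact: PD. Qed.

End Submodules.

(** Ideals are submodules of the regular module [R^o] by conversion, so Nakayama and the closure
    lemmas above apply to them directly. *)
Lemma submod_ideal (R : comPzRingType) (I : set R) :
  is_ideal I -> submod (I : R^o -> Prop).
Proof. by []. Qed.

Definition principal (R : comPzRingType) (x : R) : set R :=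
  [set a | exists c, a = c * x].

Lemma principal_ideal (R : comPzRingType) (x : R) : is_ideal (principal x).
Proof.
split; first by exists 0; rewrite mul0r.
- by move=> _ _ [c ->] [d ->]; exists (c + d); rewrite mulrDl.
- by move=> r _ [c ->]; exists (r * c); rewrite mulrA.
Qed.

Lemma principalP (R : comPzRingType) (x a : R) :
  principal x a <-> exists b, a = x * b.
Proof. by split=> -[b ->]; exists b; rewrite mulrC. Qed.

Lemma zero_ideal (R : comPzRingType) : is_ideal [set a : R | a = 0].
Proof. by split=> //= [a b -> ->|r a ->]; [exact: addr0|exact: mulr0]. Qed.

Lemma ideal_gen_mem (R : comPzRingType) n (a : 'I_n -> R) i : ideal_gen a (a i).
Proof.
exists (fun j => (j == i)%:R); rewrite (bigD1 i) //= eqxx mul1r big1 ?addr0 //.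
by move=> j /negbTE ->; rewrite mul0r.
Qed.

Lemma ideal_mul_ideal (R : comPzRingType) (I J : set R) :
  is_ideal I -> is_ideal (ideal_mul I J).
Proof.
case=> I0 ID IM; split.
- by exists 0%N, (fun=> 0), (fun=> 0); split; [case|case|rewrite big_ord0].
- move=> _ _ [m [a [b [ha hb ->]]]] [n [c [d [hc hd ->]]]].
  exists (m + n)%N.
  exists (fun i => match split i with inl j => a j | inr j => c j end).
  exists (fun i => match split i with inl j => b j | inr j => d j end).
  split; [by move=> i; case: split|by move=> i; case: split|].
  rewrite big_split_ord /=; congr (_ + _); apply: eq_bigr => i _.
    by rewrite -[lshift n i]/(unsplit (inl i)) unsplitK.
  by rewrite -[rshift m i]/(unsplit (inr i)) unsplitK.
- move=> r _ [m [a [b [ha hb ->]]]].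
  exists m, (fun i => r * a i), b; split=> // [i|]; first exact: IM.
  by rewrite mulr_sumr; apply: eq_bigr => i _; rewrite mulrA.
Qed.

Lemma ideal_mul_mem (R : comPzRingType) (I J : set R) a b :
  I a -> J b -> ideal_mul I J (a * b).
Proof.
by move=> ha hb; exists 1%N, (fun=> a), (fun=> b); split=> //; rewrite big_ord1.
Qed.

Lemma proper_ideal_sub_maximal (R : comPzRingType) (I : set R) :
  is_ideal I -> ~ I 1 -> exists N, maximal_ideal N /\ I `<=` N.
Proof.
move=> Iid I1.
pose P := [set J : set R | J = set0 \/ [/\ is_ideal J, ~ J 1 & I `<=` J]].
have [|J [PJ Jmax]] := @Zorn_bigcup R P.
  move=> F FP Ftot; have [F0|] := pselect (forall X, F X -> X = set0).
    by left; rewrite bigcup0 // => X /F0 ->.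
  move=> /existsNP [X0 /not_implyP [FX0 X0n]]; right.
  have good X : F X -> X = set0 \/ [/\ is_ideal X, ~ X 1 & I `<=` X] by move/FP.
  have [//|[[X00 X0D X0M] X01 X0I]] := good _ FX0.
  have good' X a : F X -> X a -> [/\ is_ideal X, ~ X 1 & I `<=` X].
    by move=> FX Xa; case: (good _ FX) => // E; rewrite E in Xa.
  split; last by move=> a /X0I; exists X0.
  - split; first by exists X0.
    + move=> a b [X FX Xa] [Y FY Yb].
      have [[_ XD _] _ _] := good' _ _ FX Xa; have [[_ YD _] _ _] := good' _ _ FY Yb.
      case: (Ftot _ _ FX FY) => h; first by exists Y => //; apply: YD => //; exact: h.
      by exists X => //; apply: XD => //; exact: h.
    + move=> r a [X FX Xa]; have [[_ _ XM] _ _] := good' _ _ FX Xa.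
      by exists X => //; exact: XM.
  - by move=> [X FX X1]; have [_ n1 _] := good' _ _ FX X1; exact: n1.
have PI : P I by right; split.
case: PJ => [J0|[Jid J1 IJ]].
  exfalso; apply: (Jmax I) => //; rewrite J0; split=> // h.
  by case: Iid => /h.
exists J; split=> //; split=> // K Kid K1 JK; apply/seteqP; split=> //.
apply: contrapT => KJ; apply: (Jmax K) => //; right; split=> //.
exact: subset_trans JK.
Qed.

Section LocalRing.
Variables (R : comPzRingType) (M : set R).
Hypothesis R_local : local_with M.

Lemma local_ideal : is_ideal M.
Proof. by case: R_local => -[]. Qed.

Lemma local_proper : ~ M 1.
Proof. by case: R_local => -[]. Qed.

Lemma local_unit a : ~ M a -> exists b, b * a = 1.
Proof.
move=> Ma; apply: contrapT => nu; have pid := principal_ideal a.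
have [|N [Nmax Na]] := proper_ideal_sub_maximal pid.
  by move=> [c e]; apply: nu; exists c.
by apply: Ma; rewrite -(R_local.2 _ Nmax); apply: Na; exists 1; rewrite mul1r.
Qed.

Lemma proper_sub_local (I : set R) : is_ideal I -> ~ I 1 -> I `<=` M.
Proof.
move=> Iid I1 a Ia; apply: contrapT => /local_unit [b e]; apply: I1.
by rewrite -e; case: Iid => _ _; exact.
Qed.

Lemma local_unit_sub a m : ~ M a -> M m -> ~ M (a - m).
Proof.
by move=> Ma Mm h; apply: Ma; exact: (submod_subr (submod_ideal local_ideal) h).
Qed.

(** Gaussian elimination replaces the determinant of 1 - [mu]. The first pivot is a unit because
    [mu ord0 ord0] lies in [M]; eliminating [c ord0] leaves a shorter system with coefficients again
    in [M]. Working modulo [P] avoids quotient modules. *)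
Lemma nakayama (V : lmodType R) (P : V -> Prop) n (c : 'I_n -> V)
    (mu : 'I_n -> 'I_n -> R) :
  submod P -> (forall i k, M (mu i k)) ->
  (forall i, P (c i - \sum_k mu i k *: c k)) -> forall i, P (c i).
Proof.
move=> Psub; have [P0 PD PZ] := Psub; have [_ MD MM] := local_ideal.
elim: n => [|n ih] in c mu *; first by move=> _ _ [].
move=> hmu hc; set c' := fun k => c (lift ord0 k).
have [|u eu] := @local_unit (1 - mu ord0 ord0).
  by apply: local_unit_sub => //; exact: local_proper.
have h0 : P (c ord0 - \sum_k (u * mu ord0 (lift ord0 k)) *: c' k).
  have := PZ u _ (hc ord0); rewrite big_ord_recl; congr P.
  rewrite opprD addrA -{1}[c ord0]scale1r -scalerBl scalerBr scalerA eu scale1r.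
  by rewrite scaler_sumr; congr (_ - _); apply: eq_bigr => k _; rewrite scalerA.
have h' : forall k, P (c' k).
  apply: (ih _ (fun i k => mu (lift ord0 i) (lift ord0 k) +
                mu (lift ord0 i) ord0 * (u * mu ord0 (lift ord0 k)))).
    by move=> i k; apply: MD => //; do 2 apply: (MM).
  move=> i; have := PD _ _ (hc (lift ord0 i)) (PZ (mu (lift ord0 i) ord0) _ h0).
  congr P; rewrite big_ord_recl scalerBr -/(c' i).
  have swap (v w s t : V) : v - (w + s) + (w - t) = v - (s + t).
    by rewrite !opprD !addrA (addrAC v (- w)) subrK.
  rewrite swap; congr (_ - _); rewrite scaler_sumr -big_split.
  by apply: eq_bigr => k _ /=; rewrite scalerDl scalerA.
have h00 : P (c ord0).
  by apply: (submod_subr Psub h0); apply: submod_comb.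
by move=> i; case: (unliftP ord0 i) => [j ->|->]; [exact: h'|].
Qed.

Hypothesis R_noeth : noetherian R.

Lemma nakayama_ideal (K P : set R) (y : R) : is_ideal K -> is_ideal P -> M y ->
  (forall a, K a -> exists2 b, K b & P (a - y * b)) -> K `<=` P.
Proof.
move=> Kid Pid My h; have [n [e eK]] := R_noeth Kid.
have [_ _ MM] := local_ideal.
have he i : exists c : 'I_n -> R, P (e i - y * \sum_k c k * e k).
  have : K (e i) by rewrite eK; exact: ideal_gen_mem.
  by move=> /h [b]; rewrite eK => -[c ->]; exists c.
have [c hc] := choice he.
have hP : forall i, P (e i).
  apply: (@nakayama R^o P n e (fun i k => y * c i k)) => //.
    by move=> i k; rewrite mulrC; exact: MM.
  move=> i; have := hc i; congr (P (_ - _)); rewrite mulr_sumr.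
  by apply: eq_bigr => k _; rewrite /GRing.scale /= mulrA.
move=> a; rewrite eK => -[d ->].
exact: (@submod_comb _ R^o P Pid n d e).
Qed.

(** The intersection K of the ideals P + y^n R satisfies K = P + yK, because y can be cancelled
    modulo P; Nakayama concludes. This is Krull's intersection theorem for the powers of one
    element. *)
Lemma krull (P : set R) (y : R) : is_ideal P -> M y ->
  (forall a, P (y * a) -> P a) ->
  forall a, (forall n, exists b, P (a - y ^+ n * b)) -> P a.
Proof.
move=> Pid My Py; have [P0 PD PM] := Pid; have Psub := submod_ideal Pid.
have PB := submodB Psub.
pose K : set R := [set a | forall n, exists b, P (a - y ^+ n * b)].
have Kid : is_ideal K.
  split.
  - by move=> n; exists 0; rewrite mulr0 subr0.
  - move=> a b ha hb n; have [c hc] := ha n; have [d hd] := hb n.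
    exists (c + d); have := PD _ _ hc hd; congr P; ring.
  - move=> r a ha n; have [c hc] := ha n; exists (r * c).
    have := PM r _ hc; congr P; ring.
apply: (@nakayama_ideal K P y) => // a ha.
have [b hb] := ha 1%N; rewrite expr1 in hb; exists b => // n.
have [c hc] := ha n.+1; exists c; apply: Py.
have := PB _ _ hc hb; rewrite exprS; congr P; ring.
Qed.

End LocalRing.

(** Induction on the number of forms: the values of the first one on [P] form an ideal, and its
    kernel in [P] is separated by the others. Varying the predicate on a fixed [V] spares a module
    type for that kernel. *)
Lemma noetherian_submod (R : comPzRingType) (V : lmodType R) k
    (psi : 'I_k -> {linear V -> R^o}) (P : V -> Prop) :
  noetherian R -> submod P ->
  (forall v, P v -> (forall j, psi j v = 0) -> v = 0) ->
  exists n (e : 'I_n -> V), (forall i, P (e i)) /\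
    forall v, P v -> exists c : 'I_n -> R, v = \sum_i c i *: e i.
Proof.
move=> R_noeth; elim: k => [|k ih] in psi P *.
  move=> _ h; exists 0%N, (fun=> 0); split; first by case.
  by move=> v Pv; exists (fun=> 0); rewrite big_ord0; apply: h => // -[].
move=> Psub h; have [P0 PD PZ] := Psub.
pose I : set R := [set a | exists2 v, P v & a = psi ord0 v].
have Iid : is_ideal I.
  split; first by exists 0 => //; rewrite linear0.
  - by move=> _ _ [u Pu ->] [v Pv ->]; exists (u + v); [exact: PD|rewrite linearD].
  - by move=> r _ [u Pu ->]; exists (r *: u); [exact: PZ|rewrite linearZ].
have [m [a Ia]] := R_noeth _ Iid.
have /choice [w hw] : forall i, exists v, P v /\ a i = psi ord0 v.
  by move=> i; have : I (a i) by [rewrite Ia; exact: ideal_gen_mem];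
    move=> [v Pv e]; exists v.
have [||n [e [eP eg]]] := ih (fun j => psi (lift ord0 j))
    (fun v => P v /\ psi ord0 v = 0).
- split; first by split=> //; rewrite linear0.
  + by move=> u v [Pu u0] [Pv v0]; split; [exact: PD|rewrite linearD u0 v0 addr0].
  + by move=> r u [Pu u0]; split; [exact: PZ|rewrite linearZ u0; exact: mulr0].
- move=> v [Pv v0] hv; apply: h => // j.
  by case: (unliftP ord0 j) => [j' ->|->].
exists (m + n)%N, (fun i => match split i with inl j => w j | inr j => e j end).
split; first by move=> i; case: split => j; [case: (hw j)|case: (eP j)].
move=> v Pv; have : I (psi ord0 v) by exists v.
rewrite Ia => -[c ec].
have [|d ed] := eg (v - \sum_i c i *: w i).
  split; first by apply: submodB => //; apply: submod_comb => // i; case: (hw i).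
  rewrite linearB linear_sum ec /= -sumrB big1 // => i _.
  by rewrite linearZ /= -(proj2 (hw i)) subrr.
exists (fun i => match split i with inl j => c j | inr j => d j end).
rewrite big_split_ord /= -[LHS](subrK (\sum_i c i *: w i)) ed addrC.
congr (_ + _); apply: eq_bigr => i _.
  by rewrite -[rshift m i]/(unsplit (inr i)) unsplitK.
by rewrite -[lshift n i]/(unsplit (inl i)) unsplitK.
Qed.

(** * Dual bases, base change and localization *)

Section LinearOf.
Variables (R : comPzRingType) (U V : lmodType R) (f : U -> V).
Hypothesis f_linear : linear f.
Definition linear_of_fun (u : U) : V := f u.
Fact linear_of_linear : linear linear_of_fun. Proof. exact: f_linear. Qed.
HB.instance Definition _ :=
  GRing.isLinear.Build R U V *:%R linear_of_fun linear_of_linear.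
Definition linear_of : {linear U -> V} := linear_of_fun.
Lemma linear_ofE u : linear_of u = f u. Proof. by []. Qed.
End LinearOf.

Lemma linear_bij_inv (R : comPzRingType) (U V : lmodType R) (f : {linear U -> V}) :
  bijective f -> exists k : {linear V -> U}, cancel f k /\ cancel k f.
Proof.
case=> h fK hK; have h_lin : linear h.
  by move=> a u v; apply: (can_inj fK); rewrite linearP !hK.
by exists (linear_of h_lin).
Qed.

Lemma linear_bij (R : comPzRingType) (U V : lmodType R) (f : {linear U -> V}) :
  (forall u, f u = 0 -> u = 0) -> (forall v, exists u, f u = v) -> bijective f.
Proof.
move=> inj0 /choice [h hK]; exists h => // u.
by apply/eqP; rewrite -subr_eq0; apply/eqP/inj0; rewrite linearB hK subrr.
Qed.

(** The datum of the dual basis lemma. The [w j] may be dependent, so [phi j (w i)] need not be a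
    Kronecker delta. *)
Definition dual_basis (R : comPzRingType) (V : lmodType R) n (w : 'I_n -> V)
    (phi : 'I_n -> {linear V -> R^o}) : Prop :=
  forall v, v = \sum_j (phi j v : R) *: w j.

Section DualBasis.
Variables (R : comPzRingType) (V : lmodType R).

Lemma dual_basis_eq0 n (w : 'I_n -> V) phi v :
  dual_basis w phi -> (forall j, phi j v = 0) -> v = 0.
Proof.
by move=> wphi h; rewrite (wphi v) big1 // => j _; rewrite h scale0r.
Qed.

Lemma fg_projective_dual_basis : fg_projective V ->
  exists n (w : 'I_n -> V) phi, dual_basis w phi.
Proof.
case=> -[n [w wgen]] Vproj.
have p_lin : linear (fun v : 'rV[R]_n => \sum_j v 0 j *: w j).
  move=> a u v; rewrite scaler_sumr -big_split; apply: eq_bigr => j _ /=.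
  by rewrite !mxE scalerDl scalerA.
have [|h hE] := Vproj _ _ (linear_of p_lin) (lin_id V).
  move=> v; have [c ec] := wgen v; exists (\row_j c j).
  by rewrite linear_ofE ec; apply: eq_bigr => j _; rewrite mxE.
have phi_lin j : linear (fun v => h v 0 j : R^o).
  by move=> a u v; rewrite linearP !mxE.
by exists n, w, (fun j => linear_of (phi_lin j)) => v; rewrite -[LHS]/(lin_id V v) -hE.
Qed.

Lemma dual_basis_fg_projective n (w : 'I_n -> V) phi :
  dual_basis w phi -> fg_projective V.
Proof.
move=> wphi; split.
  by exists n, w => v; exists (fun j => phi j v); rewrite -wphi.
move=> N P p f psurj; have /choice [z hz] := fun j => psurj (f (w j)).
have h_lin : linear (fun v => \sum_j (phi j v : R) *: z j).
  move=> a u v; rewrite scaler_sumr -big_split; apply: eq_bigr => j _ /=.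
  by rewrite linearP scalerDl scalerA.
exists (linear_of h_lin) => v; rewrite linear_ofE linear_sum {2}(wphi v).
by rewrite linear_sum; apply: eq_bigr => j _; rewrite !linearZ hz.
Qed.

End DualBasis.

Lemma free_fg_projective (R : comPzRingType) (V : lmodType R) n (e : 'I_n -> V) :
  (forall v, exists c : 'I_n -> R, v = \sum_i c i *: e i) ->
  (forall c : 'I_n -> R, \sum_i c i *: e i = 0 -> forall i, c i = 0) ->
  exists phi, dual_basis e phi.
Proof.
move=> /choice [c cE] ind.
have uniq (a b : 'I_n -> R) : \sum_i a i *: e i = \sum_i b i *: e i -> a = b.
  move=> ab; apply/funext => i; apply/eqP; rewrite -subr_eq0; apply/eqP.
  apply: (ind (fun i => a i - b i)).
  apply/eqP; under eq_bigr do rewrite scalerBl.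
  by rewrite sumrB subr_eq0; apply/eqP.
have phi_lin i : linear (fun v => c v i : R^o).
  move=> a u v; apply: (congr1 (@^~ i) (x := c (a *: u + v))
      (y := fun i => a * c u i + c v i)).
  apply: uniq; rewrite -cE {1}(cE u) {1}(cE v) scaler_sumr -big_split.
  by apply: eq_bigr => j _ /=; rewrite scalerDl scalerA.
by exists (fun i => linear_of (phi_lin i)) => v; exact: cE.
Qed.

Section BaseChangeDual.
Variables (R S : comPzRingType) (f : {rmorphism R -> S}) (V : lmodType R).

Lemma tens_scale1 v s : tens f v s = s *: tens f v 1 :> bc f V.
Proof. by rewrite scale_tens mulr1. Qed.

Lemma tens_scalel r v : tens f (r *: v) 1 = f r *: tens f v 1 :> bc f V.
Proof. by rewrite tensZ mulr1 tens_scale1. Qed.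

Lemma tens0 s : tens f (0 : V) s = 0.
Proof. by apply: (addIr (tens f 0 s)); rewrite -tensDl !add0r. Qed.

Lemma tens_comb n (c : 'I_n -> R) (e : 'I_n -> V) :
  tens f (\sum_i c i *: e i) 1 = \sum_i f (c i) *: tens f (e i) 1.
Proof.
elim/big_ind2: _ => [|_ u _ v <- <-|i _]; [exact: tens0|exact: tensDl|].
exact: tens_scalel.
Qed.

Section Form.
Variable phi : {linear V -> R^o}.
Definition bc_form_unit (v : V) : restr f S^o := f (phi v).
Fact bc_form_unit_linear : linear bc_form_unit.
Proof. by move=> a u v; rewrite /bc_form_unit linearP rmorphD rmorphM. Qed.
HB.instance Definition _ := GRing.isLinear.Build R V (restr f S^o) *:%R
  bc_form_unit bc_form_unit_linear.
Definition bc_form : {linear bc f V -> S^o} :=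
  bc_lift (bc_form_unit : {linear V -> restr f S^o}).
Lemma bc_formE v s : bc_form (tens f v s) = s * f (phi v).
Proof. by rewrite bc_liftE. Qed.
End Form.

Lemma bc_dual_basis n (w : 'I_n -> V) phi : dual_basis w phi ->
  dual_basis (fun j => tens f (w j) 1) (fun j => bc_form (phi j)).
Proof.
move=> wphi; elim/bc_ind => [v|a t {1}->|t u {1}-> {1}->].
- rewrite {1}(wphi v) tens_comb; apply: eq_bigr => j _.
  by rewrite bc_formE mul1r.
- rewrite scaler_sumr; apply: eq_bigr => j _.
  by rewrite [bc_form _ (a *: t)]linearZ scalerA.
- by under [RHS]eq_bigr do rewrite linearD scalerDl; rewrite big_split.
Qed.

Lemma bc_fg_projective : fg_projective V -> fg_projective (bc f V).
Proof.
move=> /fg_projective_dual_basis [n [w [phi wphi]]].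
exact: dual_basis_fg_projective (bc_dual_basis wphi).
Qed.

(** Flatness in coordinates: the extended forms take the values f(phi_j(v)) at v (x) 1, and the
    [phi j] separate points. *)
Lemma tens_inj_projective (v : V) : fg_projective V -> injective f ->
  tens f v 1 = 0 -> v = 0.
Proof.
move=> /fg_projective_dual_basis [n [w [phi wphi]]] finj v0.
apply: (dual_basis_eq0 wphi) => j; apply: finj; rewrite rmorph0.
by have := bc_formE (phi j) v 1; rewrite v0 linear0 mul1r.
Qed.

Lemma bc_span (t : bc f V) : exists n (v : 'I_n -> V) (s : 'I_n -> S),
  t = \sum_i s i *: tens f (v i) 1.
Proof.
elim/bc_class_ind: t => u; exists (size u).
exists (fun i => (nth (0, 0) u i).1), (fun i => (nth (0, 0) u i).2).
rewrite bc_class_sum (big_nth (0, 0)) big_mkord; apply: eq_bigr => i _.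
exact: tens_scale1.
Qed.

End BaseChangeDual.

Arguments bc_dual_basis {R S} f {V n w phi}.

(** * Localization at one element and the fibre product property *)

Section Localization.
Variables (R : comPzRingType) (x : R).

Lemma loc_invr n : loc_frac x 1 n * loc_map x (x ^+ n) = 1.
Proof.
rewrite [LHS]loc_mulE mul1r addn0; apply/loc_fracP; exists 0%N.
by rewrite mulr1 addn0 add0n expr0 mul1r.
Qed.

Lemma loc_frac_mulX n a : loc_frac x (x ^+ n * a) n = loc_map x a.
Proof. by have := loc_frac_cancel x n a 0; rewrite addn0. Qed.

Lemma loc_clear n a : loc_map x (x ^+ n) * loc_frac x a n = loc_map x a.
Proof. by rewrite [LHS]loc_mulE add0n loc_frac_mulX. Qed.

Lemma loc_fracE a n : loc_frac x a n = loc_frac x 1 n * loc_map x a.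
Proof. by rewrite [RHS]loc_mulE mul1r addn0. Qed.

Lemma loc_clear_family k (u : 'I_k -> loc x) :
  exists n (a : 'I_k -> R), forall i, loc_map x (x ^+ n) * u i = loc_map x (a i).
Proof.
elim: k => [|k ih] in u *.
  by exists 0%N, (fun=> 0) => -[].
have [n [a ha]] := ih (fun i => u (lift ord0 i)).
elim/loc_ind: {-1}(u ord0) (erefl (u ord0)) => b m eb.
exists (n + m)%N.
exists (fun i => if unlift ord0 i is Some j then x ^+ m * a j else x ^+ n * b).
move=> i; rewrite exprD [loc_map x (_ * _)]rmorphM -mulrA.
case: unliftP => [j|] ->; last by rewrite eb loc_clear [RHS]rmorphM.
by rewrite mulrCA ha [RHS]rmorphM.
Qed.

Lemma loc_map_inj : GRing.lreg x -> injective (loc_map x).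
Proof.
move=> x_reg a b /loc_fracP [k]; rewrite addn0.
by move: (lregX (n:=k) x_reg); exact.
Qed.

End Localization.

Section Pullback.
Variables (R R' : comPzRingType) (g : {rmorphism R -> R'}) (x : R).
Hypotheses (x_reg : GRing.lreg x) (gx_reg : GRing.lreg (g x)).
Hypothesis quo_inj : forall a b, g a = g x * b -> exists c, a = x * c.

(** An element a / x^n that agrees with v satisfies g(a) = g(x)^n v, and [quo_inj] allows x to be
    divided out of a, once for each of the n factors. So R is the fibre product of R_x and R'. *)
Lemma loc_pullback (u : loc x) (v : R') :
  loc_ind_map g x u = loc_map (g x) v ->
  exists r, u = loc_map x r /\ v = g r.
Proof.
elim/loc_ind: u => a n; rewrite loc_ind_mapE => /loc_fracP [k].
rewrite addn0 exprD -mulrA => /(lregX (n:=k) gx_reg).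
suff h : g a = g x ^+ n * v -> exists r, a = x ^+ n * r /\ v = g r.
  move=> /h [r [-> ->]]; exists r; split=> //.
  exact: loc_frac_mulX.
elim: n a => [|n ih] a; first by rewrite expr0 mul1r => e; exists a; rewrite mul1r.
rewrite exprS -mulrA => e; have [c ec] := quo_inj e.
move: e; rewrite ec rmorphM => /gx_reg /ih [r [-> ->]].
by exists r; rewrite exprS mulrA.
Qed.

(** The values of [nu] are picked pointwise, but they are forced, hence linear, because R embeds in
    R_x. *)
Lemma loc_pullback_linear (V : lmodType R) (lam : V -> loc x) (mu : V -> R') :
  (forall r u v, lam (r *: u + v) = loc_map x r * lam u + lam v) ->
  (forall r u v, mu (r *: u + v) = g r * mu u + mu v) ->
  (forall v, loc_ind_map g x (lam v) = loc_map (g x) (mu v)) ->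
  exists nu : {linear V -> R^o},
    forall v, lam v = loc_map x (nu v) /\ mu v = g (nu v).
Proof.
move=> lamP muP e.
have /choice [nu nuP] := fun v => loc_pullback (e v).
have nu_lin : linear (nu : V -> R^o).
  move=> a u v; apply: (loc_map_inj x_reg).
  have nuE w : loc_map x (nu w) = lam w by case: (nuP w).
  apply: etrans (nuE _) _; rewrite lamP -!nuE -rmorphM -rmorphD; congr loc_map.
by exists (linear_of nu_lin).
Qed.

End Pullback.

(** * Units and counits of patching *)

Lemma nat_iso_of_isos (C D : category) (F G : functor C D)
    (eta : forall a : C, hom (F a) (G a)) :
  (forall a, exists k, comp k (eta a) = idm _ /\ comp (eta a) k = idm _) ->
  (forall (a b : C) (f : hom a b),
    comp (fmor G f) (eta a) = comp (eta b) (fmor F f)) ->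
  inhabited (nat_iso F G).
Proof.
move=> isos nat.
pose k a := cid (isos a).
by constructor; exists eta (fun a => sval (k a)) => // a; case: (svalP (k a)).
Qed.

Section PatchingSquare.
Variable sq : square.
Local Notation R := (sqR sq).
Local Notation R1 := (sq1 sq).
Local Notation R2 := (sq2 sq).
Local Notation S := (sqS sq).
Local Notation g1 := (sg1 sq).
Local Notation g2 := (sg2 sq).
Local Notation h1 := (sh1 sq).
Local Notation h2 := (sh2 sq).

Lemma pd_hom_iso (X Y : patching_datum sq) (f : pd_hom X Y) :
  bijective (pd_hom1 f) -> bijective (pd_hom2 f) ->
  exists k : pd_hom Y X, pd_comp k f = pd_id X /\ pd_comp f k = pd_id Y.
Proof.
move=> /linear_bij_inv [k1 [k1K fK1]] /linear_bij_inv [k2 [k2K fK2]].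
have map_inv (A B : comPzRingType) (h : {rmorphism A -> B}) (U V : lmodType A)
    (u : {linear U -> V}) (v : {linear V -> U}) :
    cancel u v -> cancel (bc_map h u) (bc_map h v).
  move=> uK t; rewrite -[RHS]bc_map_id; apply/esym.
  have -> : lin_id U = lin_comp v u by apply: lin_ext => w /=; rewrite uK.
  exact: bc_map_comp.
have kE t : pd_iso X (bc_map h1 k1 t) = bc_map h2 k2 (pd_iso Y t).
  apply: (can_inj (map_inv _ _ h2 _ _ _ _ k2K)).
  by rewrite -pd_homE !(map_inv _ _ _ _ _ _ _ fK1) (map_inv _ _ _ _ _ _ _ fK2).
by exists (PdHom kE); split; apply: pd_hom_ext.
Qed.

Section Counit.
Variable X : patching_datum sq.

Definition glue_fst (z : glue X) : restr g1 (pd1 X) := (val z).1.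
Definition glue_snd (z : glue X) : restr g2 (pd2 X) := (val z).2.
Fact glue_fst_linear : linear glue_fst. Proof. by []. Qed.
Fact glue_snd_linear : linear glue_snd. Proof. by []. Qed.
HB.instance Definition _ := GRing.isLinear.Build R (glue X) (restr g1 (pd1 X))
  *:%R glue_fst glue_fst_linear.
HB.instance Definition _ := GRing.isLinear.Build R (glue X) (restr g2 (pd2 X))
  *:%R glue_snd glue_snd_linear.

Lemma glue_fstP r u v : glue_fst (r *: u + v) =
  g1 r *: (glue_fst u : pd1 X) + (glue_fst v : pd1 X) :> pd1 X.
Proof. exact: glue_fst_linear. Qed.

Lemma glue_sndP r u v : glue_snd (r *: u + v) =
  g2 r *: (glue_snd u : pd2 X) + (glue_snd v : pd2 X) :> pd2 X.
Proof. exact: glue_snd_linear. Qed.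

Lemma glue_fst0 : glue_fst 0 = (0 : pd1 X).
Proof. exact: (linear0 (glue_fst : {linear glue X -> restr g1 (pd1 X)})). Qed.

Lemma glue_snd0 : glue_snd 0 = (0 : pd2 X).
Proof. exact: (linear0 (glue_snd : {linear glue X -> restr g2 (pd2 X)})). Qed.

Lemma glue_fstZ r z : glue_fst (r *: z) = g1 r *: (glue_fst z : pd1 X).
Proof. by rewrite -[r *: z]addr0 glue_fstP glue_fst0 addr0. Qed.

Lemma glue_sndZ r z : glue_snd (r *: z) = g2 r *: (glue_snd z : pd2 X).
Proof. by rewrite -[r *: z]addr0 glue_sndP glue_snd0 addr0. Qed.

Lemma glue_compat z : pd_iso X (tens h1 (glue_fst z : pd1 X) 1) =
  tens h2 (glue_snd z : pd2 X) 1.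
Proof. exact: glueP. Qed.

Lemma glue_exists (m1 : pd1 X) (m2 : pd2 X) :
  pd_iso X (tens h1 m1 1) = tens h2 m2 1 ->
  exists z : glue X, glue_fst z = m1 /\ glue_snd z = m2.
Proof.
move=> e; have p : ((m1, m2) : restr g1 (pd1 X) * restr g2 (pd2 X))%type
    \in @glue_pred sq X by apply/asboolP.
by exists (Glue p).
Qed.

Lemma glue_ext (z w : glue X) :
  glue_fst z = glue_fst w -> glue_snd z = glue_snd w -> z = w.
Proof.
move=> e1 e2; apply: val_inj.
by rewrite [val z]surjective_pairing [val w]surjective_pairing; congr pair.
Qed.

Definition counit1 : {linear bc g1 (glue X) -> pd1 X} :=
  bc_lift (glue_fst : {linear glue X -> restr g1 (pd1 X)}).
Definition counit2 : {linear bc g2 (glue X) -> pd2 X} :=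
  bc_lift (glue_snd : {linear glue X -> restr g2 (pd2 X)}).

Lemma counit1E z s : counit1 (tens g1 z s) = s *: (glue_fst z : pd1 X).
Proof. exact: bc_liftE. Qed.
Lemma counit2E z s : counit2 (tens g2 z s) = s *: (glue_snd z : pd2 X).
Proof. exact: bc_liftE. Qed.

Fact counit_homE t :
  pd_iso X (bc_map h1 counit1 t) = bc_map h2 counit2 (pd_iso (F_ob (glue X)) t).
Proof.
elim/bc_ind: t => [t|s t e|t u e e'].
- elim/bc_ind: t => [z|a t e|t u e e'].
  + rewrite bc_mapE [pd_iso (F_ob _) _]base_isoE bc_mapE counit1E counit2E !scale1r.
    exact: glue_compat.
  + by rewrite tensZ -scale_tens !linearZ /= e.
  + by rewrite tensDl !linearD e e'.
- by rewrite !linearZ /= e.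
- by rewrite !linearD e e'.
Qed.

Definition counit : pd_hom (F_ob (glue X)) X :=
  PdHom (X := F_ob (glue X)) (Y := X) counit_homE.

End Counit.

Lemma counit_natural (X Y : patching_datum sq) (f : pd_hom X Y) :
  pd_comp f (counit X) = pd_comp (counit Y) (F_mor (glue_map f)).
Proof.
apply: pd_hom_ext.
  apply: (bc_lin_ext (u := lin_comp (pd_hom1 f) (counit1 X))
    (v := lin_comp (counit1 Y) (bc_map g1 (glue_map f)))) => z.
  by rewrite /= bc_mapE !counit1E !scale1r.
apply: (bc_lin_ext (u := lin_comp (pd_hom2 f) (counit2 X))
  (v := lin_comp (counit2 Y) (bc_map g2 (glue_map f)))) => z.
by rewrite /= bc_mapE !counit2E !scale1r.
Qed.

Section Unit.
Variable V : lmodType R.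

Fact glue_unit_subproof v :
  ((tens g1 v 1, tens g2 v 1) :
     restr g1 (pd1 (F_ob V)) * restr g2 (pd2 (F_ob V)))%type
  \in @glue_pred sq (F_ob V).
Proof. by apply/asboolP; rewrite [LHS]base_isoE. Qed.

Definition glue_unit_fun (v : V) : glue (F_ob V) := Glue (glue_unit_subproof v).
Fact glue_unit_linear : linear glue_unit_fun.
Proof.
move=> r u v; apply: val_inj; congr pair;
  by rewrite tensDl [in LHS]tens_scalel.
Qed.
HB.instance Definition _ := GRing.isLinear.Build R V (glue (F_ob V))
  *:%R glue_unit_fun glue_unit_linear.
Definition glue_unit : {linear V -> glue (F_ob V)} := glue_unit_fun.

Lemma glue_unit_fst v : glue_fst (glue_unit v) = tens g1 v 1. Proof. by []. Qed.
Lemma glue_unit_snd v : glue_snd (glue_unit v) = tens g2 v 1. Proof. by []. Qed.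

End Unit.

Lemma glue_unit_natural (U V : lmodType R) (f : {linear U -> V}) u :
  glue_map (F_mor f) (glue_unit U u) = glue_unit V (f u).
Proof. by apply: val_inj; congr pair; rewrite /= bc_mapE. Qed.

Lemma milnor_patching_of_units :
  (forall V : lmodType R, fg_projective V -> bijective (glue_unit V)) ->
  (forall X : patching_datum sq, pd_fg_projective X ->
    [/\ fg_projective (glue X), bijective (counit1 X) & bijective (counit2 X)]) ->
  milnor_patching_diagram sq.
Proof.
move=> unit_bij counit_bij.
have PQ (V : Mod R) : fg_projective (V : lmodType R) ->
    pd_fg_projective (F_functor sq V : patching_datum sq).
  by move=> Vfg; split; exact: bc_fg_projective.
have QP (X : PD sq) : pd_fg_projective (X : patching_datum sq) ->
    fg_projective (G_functor sq X : lmodType R).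
  by move=> /counit_bij [].
exists PQ, QP; split.
- have inv (a : full_subcategory (fun V : Mod R => fg_projective (V : lmodType R))) :
      exists k : {linear glue (F_ob (sval a : lmodType R)) -> (sval a : lmodType R)},
        cancel (glue_unit _) k /\ cancel k (glue_unit _).
    exact/linear_bij_inv/unit_bij/(svalP a).
  pose k a := cid (inv a).
  apply: (@nat_iso_of_isos _ _
    (functor_comp (functor_restrict QP) (functor_restrict PQ)) (functor_id _)
    (fun a => sval (k a))).
  + move=> a; exists (glue_unit _); case: (svalP (k a)) => K1 K2.
    by split; apply: lin_ext => u /=; [rewrite K2|rewrite K1].
  + move=> a b f; apply: lin_ext => u /=.
    have [K1 K2] := svalP (k a); have [L1 L2] := svalP (k b).
    by rewrite -{2}(K2 u) glue_unit_natural L1.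
- apply: (@nat_iso_of_isos _ _
    (functor_comp (functor_restrict PQ) (functor_restrict QP)) (functor_id _)
    (fun a => counit (sval a : patching_datum sq))).
  + move=> a; have [_ b1 b2] := counit_bij _ (svalP a).
    have [k kP] := @pd_hom_iso _ _ (counit (sval a : patching_datum sq)) b1 b2.
    by exists k.
  + by move=> a b f; exact: counit_natural.
Qed.

Hypothesis milnor : milnor_patching_diagram sq.

Lemma milnor_glue_fg_projective X :
  pd_fg_projective X -> fg_projective (@glue sq X).
Proof. by case: milnor => _ [QP _]; exact: QP. Qed.

(** The given isomorphism from F(G X) to X need not be the counit, but any morphism between them
    sends each z (x) 1 to a compatible pair, hence to an element of the glueing. So the second
    projections of the glueing generate [pd2 X]. *)
Lemma milnor_snd_span X (P : pd2 X -> Prop) : pd_fg_projective X -> submod P ->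
  (forall z : glue X, P (glue_snd z)) -> forall m, P m.
Proof.
move=> Xfg [P0 Padd PZ] hP m; case: milnor => PQ [QP [_ [iso]]].
pose X' : full_subcategory (fun X : PD sq => pd_fg_projective (X : patching_datum sq))
  := exist _ (X : PD sq) Xfg.
pose fwd := nat_fwd iso X' : pd_hom (F_ob (glue X)) X.
pose bwd := nat_bwd iso X' : pd_hom X (F_ob (glue X)).
have fb : pd_comp fwd bwd = pd_id X by exact: (nat_bwdK iso X').
have -> : m = pd_hom2 fwd (pd_hom2 bwd m).
  by rewrite -[LHS]/(pd_hom2 (pd_id X) m) -fb.
elim/bc_ind: (pd_hom2 bwd m : bc g2 (glue X)) => [z|a t e|t u e e'].
- have e : pd_iso X (tens h1 (pd_hom1 fwd (tens g1 z 1)) 1) =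
      tens h2 (pd_hom2 fwd (tens g2 z 1)) 1.
    by rewrite -!bc_mapE pd_homE [pd_iso (F_ob _) _]base_isoE.
  by have [w [_ <-]] := glue_exists e.
- by rewrite linearZ; exact: PZ.
- by rewrite linearD; exact: Padd.
Qed.

Lemma milnor_glue_unit_base :
  exists theta : {linear glue (F_ob (R^o : lmodType R)) -> R^o}, bijective theta.
Proof.
case: milnor => PQ [QP [[iso] _]].
have Rfg : fg_projective (R^o : lmodType R).
  apply: (@dual_basis_fg_projective _ R^o 1%N (fun=> 1) (fun=> lin_id _)) => v.
  by rewrite big_ord1 /= [LHS](esym (mulr1 v)).
pose a : full_subcategory (fun V : Mod R => fg_projective (V : lmodType R))
  := exist _ (R^o : Mod R) Rfg.
pose fwd := nat_fwd iso a : {linear glue (F_ob (R^o : lmodType R)) -> R^o}.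
pose bwd := nat_bwd iso a : {linear R^o -> glue (F_ob (R^o : lmodType R))}.
exists fwd; exists bwd => u.
  by have /(congr1 (fun f : {linear _ -> _} => f u)) := nat_fwdK iso a.
by have /(congr1 (fun f : {linear _ -> _} => f u)) := nat_bwdK iso a.
Qed.

End PatchingSquare.

(** * Patching along a localization square *)

Section MinimalGenerators.
Variables (R : comPzRingType) (M : set R) (V : lmodType R).
Hypothesis R_local : local_with M.

Definition generates n (e : 'I_n -> V) : Prop :=
  forall v, exists c : 'I_n -> R, v = \sum_i c i *: e i.

Definition minimal_generators n (e : 'I_n -> V) : Prop :=
  generates e /\
  forall (c : 'I_n -> R) y w, M y -> \sum_i c i *: e i = y *: w -> forall i, M (c i).

(** A family of least length works. If the i-th coefficient of a relation is outside [M], it stays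
    so after w is expanded and moved to the left, because y lies in [M]; then e_i could be
    dropped. *)
Lemma exists_minimal_generators : mod_fin_gen V ->
  exists n (e : 'I_n -> V), minimal_generators e.
Proof.
move=> [n0 [e0 gen0]].
pose Q n : bool := `[< exists e : 'I_n -> V, generates e >].
have [|n /asboolP [e egen] nmin] := @ex_minnP Q.
  by exists n0; apply/asboolP; exists e0.
exists n, e; split=> // c y w My ecw i; apply: contrapT => Mci.
have [d ed] := egen w; have [_ _ MM] := local_ideal R_local.
have [u eu] := local_unit R_local (local_unit_sub R_local Mci (MM (d i) _ My)).
case: n => [|n] in e egen nmin c ecw i Mci d ed u eu *; first by have := ltn_ord i.
suff : Q n by move/nmin; rewrite ltnn.
pose f k := - (u * (c k - d k * y)).
have ei : e i = \sum_k f (lift i k) *: e (lift i k).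
  have : \sum_k (c k - d k * y) *: e k = 0.
    under eq_bigr do rewrite scalerBl mulrC -scalerA.
    by rewrite sumrB ecw -scaler_sumr -ed subrr.
  move=> /(congr1 (fun v => u *: v)); rewrite scaler0 (bigD1_ord i) //=.
  rewrite scalerDr scalerA eu scale1r => /eqP; rewrite addr_eq0 => /eqP ->.
  rewrite scaler_sumr -sumrN; apply: eq_bigr => k _.
  by rewrite scalerA -scaleNr.
apply/asboolP; exists (fun k => e (lift i k)) => v; have [a ->] := egen v.
exists (fun k => a i * f (lift i k) + a (lift i k)).
rewrite (bigD1_ord i) //= {1}ei scaler_sumr -big_split.
by apply: eq_bigr => k _ /=; rewrite scalerDl scalerA.
Qed.

End MinimalGenerators.

Lemma free_dual_basis (R : comPzRingType) (V : lmodType R) n (e : 'I_n -> V) phi :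
  (forall c : 'I_n -> R, \sum_i c i *: e i = 0 -> forall i, c i = 0) ->
  dual_basis e phi -> forall i j, phi j (e i) = (j == i)%:R.
Proof.
move=> ind ephi i j; apply/eqP; rewrite -subr_eq0; apply/eqP.
apply: (ind (fun j => (phi j (e i) : R) - (j == i)%:R)).
under eq_bigr do rewrite scalerBl.
rewrite sumrB -ephi (bigD1 i) //= eqxx scale1r big1 ?addr0 ?subrr // => k /negbTE ->.
by rewrite scale0r.
Qed.

(** Forms on [V] do not see the glueing isomorphism of [F_ob V], so compatibility of a pair becomes
    an equality of coordinates in S. *)
Lemma base_iso_form (sq : square) (V : lmodType (sqR sq))
    (phi : {linear V -> (sqR sq)^o}) t :
  bc_form (sh2 sq) (bc_form (sg2 sq) phi) (base_iso V t) =
  bc_form (sh1 sq) (bc_form (sg1 sq) phi) t.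
Proof.
elim/bc_ind: t => [t|s t e|t u e e'].
- elim/bc_ind: t => [v|a t e|t u e e'].
  + by rewrite base_isoE !bc_formE !mul1r sqE.
  + by rewrite tensZ -scale_tens !linearZ /= e.
  + by rewrite tensDl !linearD e e'.
- by rewrite !linearZ /= e.
- by rewrite !linearD e e'.
Qed.

Lemma bc_lift_bij (R S : comPzRingType) (f : {rmorphism R -> S})
    (V : lmodType R) (N : lmodType S) (p : {linear V -> restr f N})
    n (e : 'I_n -> V) phi :
  dual_basis e phi ->
  (forall u : 'I_n -> S, \sum_i u i *: (p (e i) : N) = 0 -> forall i, u i = 0) ->
  (forall m : N, exists u : 'I_n -> S, m = \sum_i u i *: (p (e i) : N)) ->
  bijective (bc_lift p).
Proof.
move=> ephi ind span; apply: linear_bij => [t|m].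
  have dt := bc_dual_basis f ephi t; rewrite {1}dt linear_sum => t0.
  rewrite dt big1 // => i _.
  rewrite (ind (fun i => bc_form f (phi i) t)) ?scale0r // -[RHS]t0.
  by apply: eq_bigr => j _; rewrite [RHS]linearZ_LR bc_liftE scale1r.
have [u ->] := span m; exists (\sum_i tens f (e i) (u i)).
by rewrite linear_sum; apply: eq_bigr => i _; rewrite bc_liftE.
Qed.

Section LocalizationSquare.
Variables (R R' : comPzRingType) (M : set R) (x : R) (g : {rmorphism R -> R'}).
Hypotheses (R_noeth : noetherian R) (R_local : local_with M) (xM : M x).
Hypotheses (x_reg : GRing.lreg x) (gx_reg : GRing.lreg (g x)).
Hypothesis quo_inj : forall a b, g a = g x * b -> exists c, a = x * c.

Local Notation sq := (loc_square g x).
Local Notation h1 := (loc_ind_map g x).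
Local Notation h2 := (loc_map (g x)).

(** This and the next three predicates describe A -> B by congruences: an element of A invertible in
    B, common denominators for B over A, surjectivity, and a valuation property of A, by which a
    family that is nonzero modulo x equals a factor invertible in B times a family with a unit
    member. *)
Definition quo_unit (d : R) : Prop := exists u v, g d * u = 1 + g x * v.

Definition quo_fractions : Prop := forall k (r : 'I_k -> R'),
  exists d (c : 'I_k -> R), quo_unit d /\
    forall i, exists w, g d * r i = g (c i) + g x * w.

Definition quo_surjective : Prop := forall r, exists c w, r = g c + g x * w.

Definition quo_valuation : Prop := forall n (c : 'I_n -> R),
  ~ (forall i, exists d, c i = x * d) -> exists d (c' : 'I_n -> R),
    [/\ quo_unit d, forall i, exists v, c i = d * c' i + x * v &
        exists i, ~ M (c' i)].

(** If g(a) = 0 then a = xc by [quo_inj], and g(c) = 0 since g(x) is regular. So the kernel K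
    satisfies K = xK and vanishes by Nakayama. *)
Lemma base_inj : injective g.
Proof.
suff h a : g a = 0 -> a = 0.
  by move=> a b e; apply/eqP; rewrite -subr_eq0; apply/eqP/h; rewrite rmorphB e subrr.
pose K : set R := [set a | g a = 0].
have Kid : is_ideal K.
  split; first exact: rmorph0.
  - by move=> u v; rewrite /K /= rmorphD => eu ev; rewrite eu ev addr0.
  - by move=> r u; rewrite /K /= rmorphM => ->; rewrite mulr0.
apply: (nakayama_ideal R_local R_noeth Kid (@zero_ideal R) xM) => {}a /= a0.
have [|c ec] := @quo_inj a 0; first by rewrite a0 mulr0.
exists c; last by rewrite ec subrr.
by apply: gx_reg; rewrite mulr0 -rmorphM -ec.
Qed.

Lemma loc_ind_map_inj : injective h1.
Proof.
suff h u : h1 u = 0 -> u = 0.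
  by move=> u v e; apply/eqP; rewrite -subr_eq0; apply/eqP/h; rewrite rmorphB /= e subrr.
elim/loc_ind: u => a n; rewrite loc_ind_mapE => /loc_fracP [k].
rewrite mulr0 addn0 => e.
have a0 : g a = 0 by apply: (lregX (n:=k) gx_reg); rewrite e mulr0.
by rewrite loc_fracE (base_inj (etrans a0 (esym (rmorph0 g)))) rmorph0 mulr0.
Qed.

(** Coordinates in a dual basis turn a compatible pair of vectors into compatible pairs of scalars,
    which [loc_pullback] lifts to R. *)
Lemma loc_glue_unit_bij (V : lmodType R) :
  fg_projective V -> bijective (@glue_unit sq V).
Proof.
move=> Vfg; apply: linear_bij => [v v0|z].
  apply: (tens_inj_projective Vfg (loc_map_inj x_reg)).
  by rewrite -[LHS](@glue_unit_fst sq) v0 (@glue_fst0 sq).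
have [n [w [phi wphi]]] := fg_projective_dual_basis Vfg.
have W1 := bc_dual_basis (loc_map x) wphi; have W2 := bc_dual_basis g wphi.
have /choice [r rP] : forall j, exists r, bc_form (loc_map x) (phi j) (glue_fst z)
    = loc_map x r /\ bc_form g (phi j) (glue_snd z) = g r.
  move=> j; apply: (loc_pullback gx_reg quo_inj).
  have := glue_compat z => /(congr1 (bc_form h2 (bc_form g (phi j)))).
  by rewrite [LHS](@base_iso_form sq) !bc_formE !mul1r.
exists (\sum_j r j *: w j); apply: glue_ext.
  rewrite glue_unit_fst tens_comb [RHS](W1 (glue_fst z)).
  by apply: eq_bigr => j _; case: (rP j) => ->.
rewrite glue_unit_snd tens_comb [RHS](W2 (glue_snd z)).
by apply: eq_bigr => j _; case: (rP j) => _ ->.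
Qed.

(* [V], with its two projections, is the glueing of [N1] and [N2] along [zeta]. *)
Section Glued.
Variables (N1 : lmodType (loc x)) (N2 : lmodType R') (V : lmodType R).
Variables (zeta : {linear bc h1 N1 -> bc h2 N2}) (p1 : V -> N1) (p2 : V -> N2).
Hypothesis zeta_bij : bijective zeta.
Hypotheses (N1fg : fg_projective N1) (N2fg : fg_projective N2).
Hypothesis p1P : forall r u v, p1 (r *: u + v) = loc_map x r *: p1 u + p1 v.
Hypothesis p2P : forall r u v, p2 (r *: u + v) = g r *: p2 u + p2 v.
Hypothesis compat : forall z, zeta (tens h1 (p1 z) 1) = tens h2 (p2 z) 1.
Hypothesis glued : forall m1 m2, zeta (tens h1 m1 1) = tens h2 m2 1 ->
  exists z, p1 z = m1 /\ p2 z = m2.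
Hypothesis p12_inj : forall z w, p1 z = p1 w -> p2 z = p2 w -> z = w.

Let p10 : p1 0 = 0.
Proof. by have := p1P (-1) 0 0; rewrite scaler0 addr0 rmorphN1 scaleN1r addNr. Qed.

Let p20 : p2 0 = 0.
Proof. by have := p2P (-1) 0 0; rewrite scaler0 addr0 rmorphN1 scaleN1r addNr. Qed.

Let p1Z r z : p1 (r *: z) = loc_map x r *: p1 z.
Proof. by rewrite -[r *: z]addr0 p1P p10 addr0. Qed.

Let p2Z r z : p2 (r *: z) = g r *: p2 z.
Proof. by rewrite -[r *: z]addr0 p2P p20 addr0. Qed.

Let p1_comb n (c : 'I_n -> R) (e : 'I_n -> V) :
  p1 (\sum_i c i *: e i) = \sum_i loc_map x (c i) *: p1 (e i).
Proof.
elim: n c e => [|n ih] c e; first by rewrite !big_ord0 p10.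
by rewrite !big_ord_recl p1P ih.
Qed.

Let p2_comb n (c : 'I_n -> R) (e : 'I_n -> V) :
  p2 (\sum_i c i *: e i) = \sum_i g (c i) *: p2 (e i).
Proof.
elim: n c e => [|n ih] c e; first by rewrite !big_ord0 p20.
by rewrite !big_ord_recl p2P ih.
Qed.

Lemma tens1_inj (m : N1) : tens h1 m 1 = 0 -> m = 0.
Proof. exact: (tens_inj_projective N1fg loc_ind_map_inj). Qed.

Lemma tens2_inj (m : N2) : tens h2 m 1 = 0 -> m = 0.
Proof. exact: (tens_inj_projective N2fg (loc_map_inj gx_reg)). Qed.

Lemma tens2_eq (m m' : N2) : tens h2 m 1 = tens h2 m' 1 -> m = m'.
Proof.
move=> e; apply: subr0_eq; apply: tens2_inj; rewrite -scaleN1r tensDl e.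
by rewrite tens_scalel rmorphN1 scaleN1r subrr.
Qed.

Lemma snd_reg (m : N2) : g x *: m = 0 -> m = 0.
Proof.
have [n [w [phi wphi]]] := fg_projective_dual_basis N2fg => e.
apply: (dual_basis_eq0 wphi) => j; apply: gx_reg.
rewrite mulr0; apply: esym.
by have := linearZ_LR (phi j) (g x) m; rewrite e linear0.
Qed.

Lemma p1_inj z : p1 z = 0 -> z = 0.
Proof.
move=> z1; have := compat z; rewrite z1 tens0 linear0 => /esym/tens2_inj z2.
by apply: p12_inj; rewrite ?p10 ?p20.
Qed.

Lemma p2_inj z : p2 z = 0 -> z = 0.
Proof.
move=> z2; apply: p1_inj; apply: tens1_inj.
apply: (bij_inj zeta_bij); rewrite linear0.
by rewrite [LHS]compat z2 tens0.
Qed.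

Lemma glue_reg (z : V) : x *: z = 0 -> z = 0.
Proof.
move=> e; apply: p2_inj; apply: snd_reg; rewrite -p2Z e.
exact: p20.
Qed.

(** This is the embedding of N/xN into M2/x'M2: x is invertible on [N1], so [p1 z] can be divided by
    x, and the quotient still matches [m]. *)
Lemma glue_div z (m : N2) : p2 z = g x *: m -> exists w, z = x *: w.
Proof.
move=> e; have inv1 : loc_frac x 1 1 * loc_map x x = 1.
  by have := loc_invr x 1; rewrite expr1.
have inv2 : h1 (loc_frac x 1 1) * h2 (g x) = 1.
  by rewrite -loc_squareE -rmorphM inv1 rmorph1.
have [|w [w1 w2]] := @glued (loc_frac x 1 1 *: p1 z) m.
  rewrite tens_scalel linearZ /= compat e tens_scalel scalerA.
  by rewrite [_ * _]inv2 scale1r.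
exists w; apply: p12_inj.
  rewrite p1Z w1 scalerA mulrC inv1 scale1r //.
by rewrite p2Z w2 -e.
Qed.

Lemma glue_lift1 (m : N1) : exists n z, p1 z = loc_map x (x ^+ n) *: m.
Proof.
have [k [v [s es]]] := bc_span (zeta (tens h1 m 1)).
have [n [a ha]] := loc_clear_family s; exists n.
have [|z [z1 _]] := @glued (loc_map x (x ^+ n) *: m) (\sum_i a i *: v i).
  rewrite tens_scalel linearZ /= es tens_comb scaler_sumr loc_squareE rmorphXn.
  by apply: eq_bigr => i _; rewrite scalerA ha.
by exists z.
Qed.

(** The cokernel of R' (x) N -> M2 is x'-power torsion: transport m (x) 1 to the side of [N1], lift
    the vectors found there by [glue_lift1], and clear the denominators of the scalars. *)
Lemma glue_lift2 (m : N2) : exists n k (a : 'I_k -> R') (z : 'I_k -> V),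
  g x ^+ n *: m = \sum_i a i *: p2 (z i).
Proof.
have [inv _ invK] := zeta_bij.
have [k [v [s es]]] := bc_span (inv (tens h2 m 1)).
have /choice [q /choice [z hz]] := fun i => glue_lift1 (v i).
have vz i : v i = loc_frac x 1 (q i) *: p1 (z i).
  by rewrite hz scalerA loc_invr scale1r.
have [n [a ha]] := loc_clear_family (fun i => s i * h1 (loc_frac x 1 (q i))).
exists n, k, a, z; apply: tens2_eq; rewrite tens_scalel tens_comb.
rewrite -[tens _ m 1]invK es linear_sum scaler_sumr; apply: eq_bigr => i _.
rewrite ![zeta (_ *: _)]linearZ /= vz tens_scalel [zeta (_ *: _)]linearZ /= compat.
by rewrite !scalerA -ha mulrA.
Qed.

(* The coordinates of [N1], multiplied by a power of [x] clearing denominators on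
   generators of [N2], take values in [R] and embed [V] into some [R^k]. *)
Lemma glue_fin_gen : mod_fin_gen V.
Proof.
have [inv [invK Kinv]] := linear_bij_inv zeta_bij.
have [k [f [phi fphi]]] := fg_projective_dual_basis N1fg.
have [l [f' [phi' fphi']]] := fg_projective_dual_basis N2fg.
pose s j i : loc (g x) := bc_form h1 (phi j) (inv (tens h2 (f' i) 1)).
have /choice [q /choice [a aP]] := fun j => loc_clear_family (s j).
pose lam j z : loc x := loc_map x (x ^+ q j) * phi j (p1 z).
pose mu j z : R' := \sum_i (phi' i (p2 z) : R') * a j i.
have /choice [nu nuP] : forall j, exists nu : {linear V -> R^o},
    forall z, lam j z = loc_map x (nu z) /\ mu j z = g (nu z).
  move=> j; apply: (loc_pullback_linear x_reg gx_reg quo_inj).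
  - move=> r u v; rewrite /lam p1P linearP mulrDr; congr (_ + _).
    exact: mulrCA.
  - move=> r u v; rewrite /mu mulr_sumr -big_split; apply: eq_bigr => i _ /=.
    by rewrite p2P linearP mulrDl mulrA.
  - move=> z; rewrite /lam /mu rmorphM /= loc_squareE rmorphXn.
    have -> : h1 (phi j (p1 z)) = \sum_i h2 (phi' i (p2 z)) * s j i.
      have -> : h1 (phi j (p1 z)) = bc_form h1 (phi j) (tens h1 (p1 z) 1).
        by rewrite bc_formE mul1r.
      rewrite -[tens _ _ _]invK compat {1}(fphi' (p2 z)) tens_comb.
      rewrite !linear_sum; apply: eq_bigr => i _.
      by rewrite [inv _]linearZ [LHS]linearZ.
    rewrite mulr_sumr [RHS]rmorph_sum; apply: eq_bigr => i _.
    by rewrite [RHS]rmorphM /= -aP mulrCA.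
have [|//|n [e [_ egen]]] := noetherian_submod (P := fun=> True) (psi := nu) R_noeth.
- by [].
- move=> v _ v0; apply: p1_inj; apply: (dual_basis_eq0 fphi) => j.
  have [e _] := nuP j v; move: e; rewrite v0 rmorph0 /lam => e.
  have := loc_invr x (q j) => e1.
  by rewrite -[LHS]mul1r -e1 -mulrA e mulr0.
- by exists n, e => v; apply: egen.
Qed.

Lemma glue_div_quo_unit d z (w : V) : quo_unit d -> d *: z = x *: w ->
  exists w', z = x *: w'.
Proof.
move=> [u [v duv]] e; apply: (@glue_div _ (u *: p2 w - v *: p2 z)).
have h : g d *: p2 z = g x *: p2 w by rewrite -p2Z e p2Z.
rewrite scalerBr !scalerA (mulrC (g x) u) -(scalerA u) -h scalerA (mulrC u) duv.
by rewrite scalerDl scale1r addrK.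
Qed.

(** If c is nonzero modulo x, split off the factor d given by [quo_valuation]. As g(d) is invertible
    modulo x', N/xN has no d-torsion, so the cofactors satisfy a relation modulo x too. Minimality
    then puts all of them in M, although one is a unit. *)
Lemma glue_free_mod_of_valuation n (e : 'I_n -> V) (c : 'I_n -> R) w :
  quo_valuation -> minimal_generators M e -> \sum_i c i *: e i = x *: w ->
  forall i, exists d, c i = x * d.
Proof.
move=> val [_ emin] cw; apply: contrapT => /val [d [c' [dunit cE [k Mk]]]].
apply: Mk; have /choice [v vE] := cE.
have : d *: (\sum_i c' i *: e i) = x *: (w - \sum_i v i *: e i).
  rewrite scalerBr -cw !scaler_sumr -sumrB; apply: eq_bigr => i _.
  by rewrite vE scalerDl !scalerA addrK.
move=> /(glue_div_quo_unit dunit) [w' /emin]; exact.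
Qed.

Section SurjectiveModulo.
Hypothesis quo_surj : quo_surjective.

Lemma quo_surjX n (r : R') : exists c w, r = g c + g x ^+ n * w.
Proof.
elim: n => [|n [c [w ->]]]; first by exists 0, r; rewrite rmorph0 add0r mul1r.
have [c' [w' ->]] := quo_surj w; exists (c + x ^+ n * c'), w'.
by rewrite rmorphD rmorphM rmorphXn exprSr; ring.
Qed.

Lemma glue_divX n z (m : N2) : p2 z = g x ^+ n *: m ->
  exists w, z = x ^+ n *: w /\ p2 w = m.
Proof.
elim: n m => [|n ih] m e.
  by exists z; rewrite expr0 !scale1r in e *.
have [|w [zw wm]] := ih (g x *: m); first by rewrite e exprSr scalerA.
have [w' ww'] := glue_div wm; exists w'; rewrite zw ww' exprSr scalerA; split=> //.
by apply: subr0_eq; apply: snd_reg; rewrite scalerBr -wm ww' p2Z subrr.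
Qed.

Lemma glue_snd_surj (m : N2) : exists z m', m = p2 z + g x *: m'.
Proof.
have [n [k [a [z e]]]] := glue_lift2 m.
(* Precision n + 1 is needed: after division by x'^n the error must still be a multiple of x'. *)
have /choice [b /choice [w bw]] := fun i => quo_surjX n.+1 (a i).
have e' : p2 (\sum_i b i *: z i) =
    g x ^+ n *: (m - g x *: \sum_i w i *: p2 (z i)).
  rewrite scalerBr e p2_comb scalerA -exprSr scaler_sumr -sumrB.
  by apply: eq_bigr => i _; rewrite bw scalerDl !scalerA addrK.
have [v [_ ve]] := glue_divX e'.
by exists v, (\sum_i w i *: p2 (z i)); rewrite ve subrK.
Qed.

(* Modulo [x] the coordinate matrix of the [p2 (e k)] in a dual basis of [N2] factors
   a matrix [t] over [R] through which the [e k] reproduce themselves; by minimality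
   [t] is the identity modulo [M]. *)
Lemma glue_free_mod_of_surj n (e : 'I_n -> V) (c : 'I_n -> R) w :
  minimal_generators M e -> \sum_i c i *: e i = x *: w ->
  forall i, exists d, c i = x * d.
Proof.
move=> [egen emin] cw.
have [l [f [phi fphi]]] := fg_projective_dual_basis N2fg.
have /choice [z /choice [y fzy]] := fun j => glue_snd_surj (f j).
have /choice [a za] := fun j => egen (z j).
have /choice [t /choice [v tv]] : forall k, exists t : 'I_n -> R,
    exists v : 'I_n -> R', forall i,
    \sum_j (phi j (p2 (e k)) : R') * g (a j i) = g (t i) + g x * v i.
  move=> k; have /choice [t /choice [v tv]] := fun i =>
    quo_surj (\sum_j (phi j (p2 (e k)) : R') * g (a j i)).
  by exists t, v.
have Mt k i : M ((i == k)%:R - t k i).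
  have : p2 (\sum_i ((i == k)%:R - t k i) *: e i) =
      g x *: (\sum_i v k i *: p2 (e i) + \sum_j (phi j (p2 (e k)) : R') *: y j).
    under eq_bigr do rewrite scalerBl.
    rewrite sumrB (bigD1 k) //= eqxx scale1r big1 ?addr0; last first.
      by move=> j /negbTE ->; rewrite scale0r.
    rewrite -[_ - _]addrC -scaleN1r p2P rmorphN1 scaleN1r addrC; apply/eqP.
    rewrite subr_eq p2_comb {1}(fphi (p2 (e k))) scalerDr addrAC; apply/eqP.
    have -> : g x *: (\sum_i v k i *: p2 (e i)) + \sum_i g (t k i) *: p2 (e i) =
        \sum_j (phi j (p2 (e k)) : R') *: p2 (z j).
      rewrite scaler_sumr -big_split /=.
      under [RHS]eq_bigr do rewrite za p2_comb scaler_sumr.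
      rewrite exchange_big; apply: eq_bigr => j _ /=.
      rewrite scalerA -scalerDl addrC -tv scaler_suml.
      by apply: eq_bigr => m _; rewrite scalerA.
    rewrite scaler_sumr -big_split; apply: eq_bigr => j _ /=.
    by rewrite scalerA (mulrC (g x)) -scalerA -scalerDr -fzy.
  by move=> /glue_div [w' /(emin _ x w' xM)]; exact.
suff h : forall i, principal x (c i) by
  move=> i; have [d ->] := h i; exists d; rewrite mulrC.
(* Each sum_k c_k t_ki turns out to be divisible by x. So, modulo x, c solves c_i = sum_k (delta_ik
   - t_ki) c_k, a system whose coefficients lie in M by [Mt]. *)
apply: (nakayama R_local (V := R^o) (P := principal x : R^o -> Prop)
    (mu := fun i k => (i == k)%:R - t k i)) => // [|i].
  exact: principal_ideal.
have phic j : \sum_k g (c k) * (phi j (p2 (e k)) : R') = g x * phi j (p2 w).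
  have := congr1 (phi j \o p2) cw; rewrite /= p2_comb p2Z linear_sum => e1.
  rewrite -[RHS]linearZ_LR -e1; apply: eq_bigr => k _.
  by rewrite [RHS]linearZ.
have [|d ed] := @quo_inj (\sum_k c k * t k i)
    (\sum_j phi j (p2 w) * g (a j i) - \sum_k g (c k) * v k i).
  rewrite rmorph_sum mulrBr !mulr_sumr.
  under [X in X - _]eq_bigr do rewrite mulrA -phic mulr_suml.
  rewrite exchange_big -sumrB; apply: eq_bigr => k _ /=.
  under eq_bigr do rewrite -mulrA.
  by rewrite -mulr_sumr tv rmorphM; ring.
exists d; rewrite mulrC -ed; under [X in _ - X]eq_bigr do rewrite scalerBl.
rewrite sumrB (bigD1 i) //= eqxx scale1r big1 ?addr0; last first.
  by move=> k; rewrite eq_sym => /negbTE ->; rewrite scale0r.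
by rewrite opprB addrC subrK; apply: eq_bigr => k _; rewrite mulrC.
Qed.

End SurjectiveModulo.

(** * Freeness of the glueing and bijectivity of the counits *)

Variables (n : nat) (e : 'I_n -> V).
Hypothesis e_gen : generates e.
Hypothesis e_free_mod : forall (c : 'I_n -> R) w,
  \sum_i c i *: e i = x *: w -> forall i, exists d, c i = x * d.

(** The coefficients of a relation are divisible by x, and the quotients form a relation again
    because x is regular on V. So the coefficients are divisible by all powers of x and vanish by
    Krull's intersection theorem. *)
Lemma glue_free (c : 'I_n -> R) : \sum_i c i *: e i = 0 -> forall i, c i = 0.
Proof.
move=> c0 i; apply: (krull R_local R_noeth (@zero_ideal R) xM).
  by move=> a /= xa; apply: x_reg; rewrite mulr0.
suff h m : exists d : 'I_n -> R, (forall i, c i = x ^+ m * d i) /\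
    \sum_i d i *: e i = 0.
  by move=> m; have [d [cd _]] := h m; exists (d i); rewrite /= cd subrr.
elim: m => [|m [d [cd d0]]].
  by exists c; split=> // j; rewrite mul1r.
have /e_free_mod /choice [d' dd'] : \sum_i d i *: e i = x *: 0.
  by rewrite scaler0.
exists d'; split=> [j|]; first by rewrite cd dd' exprSr mulrA.
apply: glue_reg; rewrite scaler_sumr -[RHS]d0; apply: eq_bigr => j _.
by rewrite scalerA dd'.
Qed.

Lemma glue_counit1_inj (u : 'I_n -> loc x) :
  \sum_i u i *: p1 (e i) = 0 -> forall i, u i = 0.
Proof.
have [m [a ma]] := loc_clear_family u => u0 i.
have a0 : \sum_i a i *: e i = 0.
  apply: p1_inj; rewrite p1_comb.
  transitivity (loc_map x (x ^+ m) *: \sum_i u i *: p1 (e i)).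
    by rewrite scaler_sumr; apply: eq_bigr => j _; rewrite scalerA ma.
  by rewrite u0 scaler0.
by rewrite -[LHS]mul1r -(loc_invr x m) -mulrA ma (glue_free a0) rmorph0 mulr0.
Qed.

Lemma glue_counit1_surj (m : N1) :
  exists u : 'I_n -> loc x, m = \sum_i u i *: p1 (e i).
Proof.
have [q [z hz]] := glue_lift1 m; have [c cz] := e_gen z.
exists (fun i => loc_frac x 1 q * loc_map x (c i)).
rewrite -[LHS]scale1r -(loc_invr x q) -scalerA -hz cz p1_comb scaler_sumr.
by apply: eq_bigr => i _; rewrite scalerA.
Qed.

(** Through [zeta] a relation among the p2(e_i) becomes one over S among the p1(e_i). These form a
    basis of [N1], so they stay independent over S, and R' embeds in S. *)
Lemma glue_counit2_inj (r : 'I_n -> R') :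
  \sum_i r i *: p2 (e i) = 0 -> forall i, r i = 0.
Proof.
have [chi chiP] := free_fg_projective glue_counit1_surj glue_counit1_inj.
have delta := free_dual_basis glue_counit1_inj chiP.
move=> r0 i; apply: (loc_map_inj gx_reg); rewrite rmorph0.
have r1 : \sum_i h2 (r i) *: tens h1 (p1 (e i)) 1 = 0.
  apply: (bij_inj zeta_bij); rewrite linear0 linear_sum.
  rewrite -[RHS](tens0 h2 N2 1) -r0 tens_comb; apply: eq_bigr => j _.
  by rewrite [LHS]linearZ /= compat.
have := congr1 (bc_form h1 (chi i)) r1; rewrite linear0 linear_sum => <-.
rewrite (bigD1 i) //= big1 ?addr0 => [|j /negbTE ji].
  by rewrite linearZ /= bc_formE mul1r delta eqxx rmorph1; exact/esym/mulr1.
by rewrite linearZ /= bc_formE mul1r delta eq_sym ji rmorph0 scaler0.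
Qed.

Hypothesis fractions : quo_fractions.

(** Independence modulo x passes from A to B: a common denominator d moves the coefficients into R
    modulo x', where [glue_div] and [e_free_mod] apply, and d is then removed, being invertible
    modulo x'. *)
Lemma glue_free_mod2 (r : 'I_n -> R') m :
  \sum_i r i *: p2 (e i) = g x *: m -> forall i, exists s, r i = g x * s.
Proof.
move=> rm; have [d [c [[u [v duv]] /choice [w dw]]]] := fractions r.
have : p2 (\sum_i c i *: e i) = g x *: (g d *: m - \sum_i w i *: p2 (e i)).
  rewrite scalerBr scalerA mulrC -scalerA -rm p2_comb !scaler_sumr -sumrB.
  by apply: eq_bigr => i _; rewrite !scalerA dw scalerDl addrK.
move=> /glue_div [z /e_free_mod cx] i; have [b cb] := cx i.
exists (u * (g b + w i) - v * r i).
transitivity ((1 + g x * v) * r i - g x * v * r i); first by ring.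
by rewrite -duv mulrAC dw cb rmorphM; ring.
Qed.

(** Some x'^q m lies in the span of the p2(e_i). If x' times a vector lies in the span, its
    coefficients there are divisible by x', so q can be lowered to 0. *)
Lemma glue_counit2_surj (m : N2) :
  exists r : 'I_n -> R', m = \sum_i r i *: p2 (e i).
Proof.
have [q [k [a [z e1]]]] := glue_lift2 m.
have /choice [c cz] := fun i => e_gen (z i).
have : exists r : 'I_n -> R', g x ^+ q *: m = \sum_i r i *: p2 (e i).
  exists (fun i => \sum_j a j * g (c j i)); rewrite e1.
  under eq_bigr do rewrite cz p2_comb scaler_sumr.
  rewrite exchange_big; apply: eq_bigr => i _ /=; rewrite scaler_suml.
  by apply: eq_bigr => j _; rewrite scalerA.
move=> {e1}; elim: q m => [|q ih] m; first by rewrite expr0 scale1r.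
move=> [r er]; apply: ih.
have e2 : \sum_i r i *: p2 (e i) = g x *: (g x ^+ q *: m).
  by rewrite -er exprS scalerA.
have /choice [s rs] := glue_free_mod2 e2.
exists s; apply: subr0_eq; apply: snd_reg; rewrite scalerBr -e2 scaler_sumr.
by rewrite -sumrB big1 // => i _; rewrite scalerA rs subrr.
Qed.

End Glued.

Lemma loc_milnor_patching :
  quo_fractions -> quo_surjective \/ quo_valuation -> milnor_patching_diagram sq.
Proof.
move=> fractions surj_or_val; apply: milnor_patching_of_units.
  exact: loc_glue_unit_bij.
move=> X [X1fg X2fg].
pose V : lmodType R := G_functor sq X.
pose N1 : lmodType (loc x) := pd1 X; pose N2 : lmodType R' := pd2 X.
pose zeta : {linear bc h1 N1 -> bc h2 N2} := pd_iso X.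
pose p1 : V -> N1 := @glue_fst _ X; pose p2 : V -> N2 := @glue_snd _ X.
have zbij : bijective zeta := pd_bij X.
have p1P r u v : p1 (r *: u + v) = loc_map x r *: p1 u + p1 v.
  exact: glue_fstP.
have p2P r u v : p2 (r *: u + v) = g r *: p2 u + p2 v.
  exact: glue_sndP.
have compat z : zeta (tens h1 (p1 z) 1) = tens h2 (p2 z) 1.
  exact: glue_compat.
have glued m1 m2 : zeta (tens h1 m1 1) = tens h2 m2 1 ->
    exists z, p1 z = m1 /\ p2 z = m2.
  exact: glue_exists.
have p12_inj z w : p1 z = p1 w -> p2 z = p2 w -> z = w.
  exact: glue_ext.
have Vfg : mod_fin_gen V.
  exact: (glue_fin_gen zbij X1fg X2fg p1P p2P compat p12_inj).
have [n [e emin]] := exists_minimal_generators R_local Vfg.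
have e_gen : generates e by case: emin.
have e_free_mod (c : 'I_n -> R) w :
    \sum_i c i *: e i = x *: w -> forall i, exists d, c i = x * d.
  (* The two alternatives serve only to obtain this independence modulo x. *)
  case: surj_or_val => h.
    exact: (glue_free_mod_of_surj zbij X2fg p1P p2P compat glued p12_inj h emin).
  exact: (glue_free_mod_of_valuation p1P p2P compat glued p12_inj h emin).
have efree := glue_free zbij X1fg X2fg p1P p2P compat p12_inj e_free_mod.
have [phi ephi] := free_fg_projective e_gen efree.
split; first exact: dual_basis_fg_projective ephi.
- apply: (bc_lift_bij ephi).
    exact: (glue_counit1_inj zbij X1fg X2fg p1P p2P compat p12_inj e_free_mod).
  exact: (glue_counit1_surj p1P glued e_gen).
- apply: (bc_lift_bij ephi).
    exact: (glue_counit2_inj zbij X1fg X2fg p1P p2P compat glued p12_inj e_gen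
      e_free_mod).
  exact: (glue_counit2_surj zbij X2fg p1P p2P compat glued p12_inj e_gen
      e_free_mod fractions).
Qed.

End LocalizationSquare.

(** * Two-dimensional regular local rings *)

Lemma krull_factor (R : comPzRingType) (M : set R) (R_local : local_with M)
    (R_noeth : noetherian R) (P : set R) (y : R) n (c : 'I_n -> R) :
  is_ideal P -> M y -> (forall a, P (y * a) -> P a) -> ~ (forall i, P (c i)) ->
  exists m (c' : 'I_n -> R), (forall i, P (c i - y ^+ m * c' i)) /\
    ~ (forall i, exists b, P (c' i - y * b)).
Proof.
move=> Pid My Py Pc; have [P0 PD PM] := Pid.
(* The least m for which some c_i is not divisible by y^m modulo P exists by [krull] and is
   positive; the exponent sought is one less. *)
pose Q m := `[< ~ forall i, exists b, P (c i - y ^+ m * b) >].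
have [|m /asboolP Qm mmin] := @ex_minnP Q.
  apply: contrapT => nQ; apply: Pc => i.
  apply: (krull R_local R_noeth Pid My Py) => m; apply: contrapT => h.
  by apply: nQ; exists m; apply/asboolP => /(_ i).
case: m Qm mmin => [|m] Qm mmin.
  by exfalso; apply: Qm => i; exists (c i); rewrite mul1r subrr.
have : ~~ Q m by apply/negP => /mmin; rewrite ltnn.
move=> /asboolPn /contrapT /choice [c' cc']; exists m, c'; split=> // h.
apply: Qm => i; have [b hb] := h i; exists b.
have := PD _ _ (cc' i) (PM (y ^+ m) _ hb); congr P.
by rewrite exprSr; ring.
Qed.

Section RegularPair.
Variables (R : comPzRingType) (M : set R) (x y : R).
Hypotheses (R_noeth : noetherian R) (R_local : local_with M).
Hypotheses (xM : M x) (yM : M y) (M_xy : forall m, M m -> exists a b, m = a * y + x * b).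
Hypothesis y_reg : forall a, (exists b, y * a = x * b) -> exists b, a = x * b.

Let pid := principal_ideal x.

(** R/(x) is treated as a discrete valuation ring with uniformizer y. Once the largest common power
    of y is extracted, some cofactor is not divisible by y modulo x; as M = (x, y), that cofactor is
    outside M. *)
Lemma quo_factor n (c : 'I_n -> R) : ~ (forall i, exists d, c i = x * d) ->
  exists m (c' : 'I_n -> R), (forall i, exists v, c i = y ^+ m * c' i + x * v) /\
    exists i, ~ M (c' i).
Proof.
move=> cx; have [||m [c' [cc' c'M]]] := krull_factor R_local R_noeth (c := c) pid yM.
- by move=> a /principalP /y_reg /principalP.
- by move=> h; apply: cx => i; apply/principalP.
exists m, c'; split=> [i|].
  by have [v e] := cc' i; exists v; rewrite (mulrC x) -e addrC subrK.
apply: contrapT => /forallNP Mc'; apply: c'M => i.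
have /contrapT /M_xy [a [b ->]] := Mc' i; exists a, b.
by ring.
Qed.

Lemma quo_factor1 a : ~ (exists d, a = x * d) ->
  exists m u, ~ M u /\ exists v, a = y ^+ m * u + x * v.
Proof.
move=> ax; have [|m [u [au [i Mu]]]] := @quo_factor 1%N (fun=> a).
  by move=> /(_ ord0).
by exists m, (u i); split=> //; exact: au.
Qed.

Hypothesis x_reg : GRing.lreg x.
Hypothesis y_x : ~ exists d, y = x * d.

Lemma quo_domain a b : (exists d, a * b = x * d) ->
  (exists d, a = x * d) \/ (exists d, b = x * d).
Proof.
move=> [d abd]; apply: contrapT => /not_orP [ax bx].
have [m [u [Mu [v av]]]] := quo_factor1 ax.
have [u' eu] := local_unit R_local Mu; apply: bx.
have : exists d, y ^+ m * b = x * d.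
  exists (u' * (d - v * b)); rewrite mulrCA mulrBr -abd av.
  transitivity ((u' * u) * (y ^+ m * b)); [by rewrite eu mul1r|ring].
elim: m {av} => [|m ih]; first by rewrite expr0 mul1r.
by move=> [e ee]; apply/ih/y_reg; exists e; rewrite -ee exprS mulrA.
Qed.

Lemma not_mul_eq1 : ~ exists d : R, 1 = x * d.
Proof.
move=> [d e]; apply: (local_proper R_local); rewrite e mulrC.
by case: (local_ideal R_local) => _ _; exact.
Qed.

Lemma prime_principal_x : prime_ideal (principal x).
Proof.
split=> // [/principalP /not_mul_eq1 //|a b /principalP /quo_domain []] /principalP;
  by [left|right].
Qed.

(** Extract the largest powers of x from both factors. The cofactors still have product 0, so one of
    them is divisible by x because (x) is prime, against maximality. *)
Lemma regular_domain (a b : R) : a * b = 0 -> a = 0 \/ b = 0.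
Proof.
move=> ab; apply: contrapT => /not_orP [a0 b0].
have factor c : c <> 0 -> exists m c', c = x ^+ m * c' /\ ~ exists d, c' = x * d.
  move=> c0; have [||m [c' [cc' nc']]] :=
    @krull_factor R M R_local R_noeth _ x 1%N (fun=> c) (@zero_ideal R) xM.
  - by move=> z /= xz; apply: x_reg; rewrite mulr0.
  - by move=> /(_ ord0).
  exists m, (c' ord0); split; first exact: (subr0_eq (cc' ord0)).
  by move=> [d dE]; apply: nc' => i; exists d; rewrite (ord1 i) dE /= subrr.
have [m [a' [ea na]]] := factor _ a0; have [k [b' [eb nb]]] := factor _ b0.
have : a' * b' = 0.
  apply: (lregX (n := m + k) x_reg); rewrite mulr0 -ab ea eb exprD; ring.
by move=> ab'; case: (@quo_domain a' b') => //; exists 0; rewrite mulr0.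
Qed.

Lemma prime_expr (P : set R) a m : prime_ideal P -> P (a ^+ m) -> P a.
Proof.
case=> Pid P1 Pp; elim: m => [|m ih]; first by rewrite expr0 => /P1.
by rewrite exprS => /Pp [].
Qed.

(* If [x] is not in [P], then [P / xP] is an ideal of the valuation ring [R / x], hence
   principal, and Nakayama applies. *)
Lemma prime_principal (P : set R) : prime_ideal P -> ~ M `<=` P ->
  exists h, P = principal h.
Proof.
move=> Pprime MP; have [Pid P1 Pp] := Pprime; have [P0 PD PM] := Pid.
have [_ _ MM] := local_ideal R_local.
have unitP u : ~ M u -> ~ P u.
  by move=> /(local_unit R_local) [u' e] Pu; apply: P1; rewrite -e; exact: PM.
have [Px|Px] := pselect (P x).
  (* An element of P outside (x) is y^m times a unit modulo x, so y would lie in P, and P would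
     contain M. *)
  exists x; apply/seteqP; split=> [q Pq|_ [c ->]]; last exact: PM.
  apply/principalP; apply: contrapT => /quo_factor1 [m [u [Mu [v qv]]]].
  have : P (y ^+ m * u).
    have -> : y ^+ m * u = q + (- v) * x by rewrite qv; ring.
    by apply: PD => //; exact: PM.
  move=> /Pp [/(prime_expr Pprime) Py|/(unitP u Mu) //].
  by apply: MP => z /M_xy [a [b ->]]; apply: PD; [|rewrite mulrC]; exact: PM.
have Pdiv a b : P a -> a = x * b -> P b.
  by move=> + e; rewrite e => /Pp [].
have [n [a aP]] := R_noeth Pid.
(* If x divides all the generators, then P = xP, as x is outside the prime P; hence P = 0. *)
have [ax|ax] := pselect (forall i, exists d, a i = x * d).
  exists 0; apply/seteqP; split=> [q Pq|_ [c ->]]; last by rewrite mulr0.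
  apply: (nakayama_ideal R_local R_noeth Pid (principal_ideal 0) xM) Pq.
  move=> {}q Pq; have [c qc] : ideal_gen a q by rewrite -aP.
  have /choice [d ad] := ax.
  have e : q = x * (\sum_i c i * d i).
    by rewrite qc mulr_sumr; apply: eq_bigr => i _; rewrite ad mulrCA.
  exists (\sum_i c i * d i); first exact: Pdiv Pq e.
  by exists 0; rewrite e subrr mulr0.
have [m [a' [/choice [v av] [k Mk]]]] := quo_factor ax.
have [u eu] := local_unit R_local Mk.
have Pak : P (a k) by rewrite aP; exact: ideal_gen_mem.
exists (a k); apply/seteqP; split=> [q Pq|_ [c ->]]; last exact: PM.
apply: (nakayama_ideal R_local R_noeth Pid (principal_ideal (a k)) xM) Pq.
move=> {}q Pq; have [c qc] : ideal_gen a q by rewrite -aP.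
have ai i : a i = a' i * u * a k + x * (v i - a' i * u * v k).
  rewrite {1}av [a k]av mulrBr mulrDr.
  transitivity (y ^+ m * a' i * (u * a' k) + x * v i); [by rewrite eu mulr1|ring].
have e : q - (\sum_i c i * (a' i * u)) * a k =
    x * (\sum_i c i * (v i - a' i * u * v k)).
  rewrite qc mulr_suml mulr_sumr -sumrB; apply: eq_bigr => i _.
  by rewrite {1}ai; ring.
exists (\sum_i c i * (v i - a' i * u * v k)).
  apply: Pdiv e; have PB := submodB (submod_ideal Pid); apply: PB => //.
  exact: PM.
by exists (\sum_i c i * (a' i * u)); rewrite -e subKr.
Qed.

(** With f = rh and f prime, f divides r or h. In the first case cancelling f makes h a unit; in the
    second the two ideals agree. *)
Lemma principal_strict (f h : R) : f <> 0 -> prime_ideal (principal f) ->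
  prime_ideal (principal h) -> ~ principal f `<` principal h.
Proof.
move=> f0 [_ _ fp] [_ h1 _] [fh hf].
have [r er] : principal h f by apply: fh; exists 1; rewrite mul1r.
have : principal f (r * h) by exists 1; rewrite -er mul1r.
move=> /fp [[s es]|[s es]]; last first.
  by apply: hf => _ [c ->]; exists (c * s); rewrite es mulrA.
have : f * (1 - s * h) = 0 by rewrite mulrBr mulr1 {1}er es; ring.
move=> /regular_domain [//|e]; apply: h1; exists s; exact: subr0_eq.
Qed.

(** The chain 0, (x), M gives the lower bound. In a chain of four primes the second and the third
    are nonzero and do not contain M, so both are principal, which [principal_strict] excludes. *)
Lemma regular_pair_krull_dim2 : has_krull_dim R 2.
Proof.
have [M0 MD MM] := local_ideal R_local.
have x0 : x <> 0.
  by move=> e; apply: not_mul_eq1; exists 1; apply: x_reg; rewrite e !mul0r.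
split.
  exists (fun i : 'I_3 => match val i with
    | 0%N => [set z | z = 0] | 1%N => principal x | _ => M end).
  have Mprime : prime_ideal M.
    split=> //; first exact: local_proper R_local.
    move=> a b Mab; apply: contrapT => /not_orP [/(local_unit R_local) [a' ea] Mb].
    by apply: Mb; rewrite -(mul1r b) -ea -mulrA; exact: MM.
  have zprime : prime_ideal [set z : R | z = 0].
    split; [exact: zero_ideal| |by move=> a b /= /regular_domain].
    by move=> /= e; apply: x0; rewrite -(mulr1 x) e mulr0.
  split; first by case=> -[|[|[|]]] //= _; exact: prime_principal_x.
  have zx : [set z | z = 0] `<` principal x.
    split=> [z /= ->|h]; first by exists 0; rewrite mul0r.
    by apply: x0; apply: h; exists 1; rewrite mul1r.
  have xMlt : principal x `<` M.
    split=> [_ [c ->]|/(_ _ yM) /principalP /y_x //]; exact: MM.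
  have zM : [set z | z = 0] `<` M.
    by split=> [z /= ->|h] //; apply: x0; exact: h.
  by case=> -[|[|[|]]] //= ? [[|[|[|]]]] //= ?.
move=> n p [pprime plt]; rewrite leqNgt; apply/negP => n2.
pose o k (h : (k <= 3)%N) : 'I_n.+1 := Ordinal (leq_ltn_trans h (n2 : (3 < n.+1)%N)).
pose P := p (@o 1%N isT); pose Q := p (@o 2%N isT).
have P0 : exists2 z, P z & z <> 0.
  have [_ h] := plt (@o 0%N isT) (@o 1%N isT) isT.
  apply: contrapT => nz; apply: h => z Pz; have [[pz _ _] _ _] := pprime (@o 0%N isT).
  have -> // : z = 0 by apply: contrapT => z0; apply: nz; exists z.
have p3M : p (@o 3%N isT) `<=` M.
  by have [pid3 p31 _] := pprime (@o 3%N isT); exact: (proper_sub_local R_local).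
have PQ : P `<` Q by exact: plt.
have [_ Q3] : Q `<` p (@o 3%N isT) by exact: plt.
have MQ : ~ M `<=` Q by move=> h; apply: Q3; exact: subset_trans p3M h.
have MP : ~ M `<=` P by move=> h; apply: MQ; apply: subset_trans h PQ.1.
have Pprime : prime_ideal P := pprime _; have Qprime : prime_ideal Q := pprime _.
have [f ef] := prime_principal Pprime MP; have [h eh] := prime_principal Qprime MQ.
rewrite ef in P0 Pprime PQ; rewrite eh in Qprime PQ.
apply: principal_strict PQ => //.
by move=> f0; case: P0 => z [c ->]; rewrite f0 mulr0.
Qed.

Lemma regular_pair_regular_local : regular_local M 2.
Proof.
split=> //; first exact: regular_pair_krull_dim2.
exists (fun i : 'I_2 => if i == ord0 then y else x); apply/seteqP; split=> m.
  move=> /M_xy [a [b ->]]; exists (fun i => if i == ord0 then a else b).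
  by rewrite !big_ord_recl big_ord0 addr0 /= mulrC (mulrC x).
have [_ MD MM] := local_ideal R_local.
move=> [c ->]; rewrite !big_ord_recl big_ord0 addr0 /=.
by apply: MD; exact: MM.
Qed.

End RegularPair.

(** * Fraction fields *)

Lemma fraction_rep (D : idomainType) (z : {fraction D}) :
  exists a b : D, b != 0 /\ z * tofrac b = tofrac a.
Proof.
elim/quotW: z => r; exists (\n_r), (\d_r); split; first exact: denom_ratioP.
rewrite -[LHS]/(FracField.mul _ _) !piE; apply/eqmodP => /=.
rewrite FracField.equivfE /FracField.mulf.
by rewrite !numden_Ratio ?(mulf_neq0, oner_neq0, denom_ratioP) // !mulr1 mulrC.
Qed.

(* The type depends on the proof that [x] is prime, so that instances can use it. *)
Definition quo_dom (R : comPzRingType) (x : R)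
  (x_prime : prime_ideal (principal x)) : Type := quo x.

Section PrimeQuotient.
Variables (R : comPzRingType) (x : R) (x_prime : prime_ideal (principal x)).
Local Notation D := (quo_dom x_prime).

HB.instance Definition _ := GRing.ComPzRing.copy D (quo x).

Let x_prime1 : ~ principal x 1. Proof. by case: x_prime. Qed.

Let x_primeM a b : principal x (a * b) -> principal x a \/ principal x b.
Proof. by case: x_prime => _ _; exact. Qed.

Lemma quo_class_eq0 a : quo_class x a = 0 <-> principal x a.
Proof. by rewrite -(rmorph0 (quo_class x)) quo_classP subr0. Qed.

Fact quo_dom_oner_neq0 : (1 : D) != 0.
Proof.
by apply/eqP => /quo_class_eq0.
Qed.
HB.instance Definition _ := GRing.PzSemiRing_isNonZero.Build D quo_dom_oner_neq0.

(** An [idomainType] carries a unit predicate and an inverse. Both are chosen classically, the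
    inverse being the identity off the units. *)
Definition quo_dom_unit : pred D := fun a => `[< exists b, b * a = 1 >].
Definition quo_dom_inv (a : D) : D :=
  if pselect (exists b, b * a = 1) is left h then sval (cid h) else a.
Fact quo_dom_mulVr : {in quo_dom_unit, left_inverse 1 quo_dom_inv *%R}.
Proof.
move=> a /asboolP h; rewrite /quo_dom_inv; case: pselect => // h'.
exact: (svalP (cid h')).
Qed.
Fact quo_dom_unitPl a b : b * a = 1 -> quo_dom_unit a.
Proof. by move=> e; apply/asboolP; exists b. Qed.
Fact quo_dom_inv_out : {in [predC quo_dom_unit], quo_dom_inv =1 id}.
Proof.
by move=> a /asboolPn h; rewrite /quo_dom_inv; case: pselect => // /h.
Qed.
HB.instance Definition _ := GRing.ComNzRing_hasMulInverse.Build D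
  quo_dom_mulVr quo_dom_unitPl quo_dom_inv_out.

Fact quo_dom_integral : GRing.integral_domain_axiom D.
Proof.
move=> a b; rewrite -(quo_reprK a) -(quo_reprK b).
move: (quo_repr a) (quo_repr b) => {}a {}b ab.
have : quo_class x (a * b) = 0 by rewrite rmorphM; exact: ab.
move=> /quo_class_eq0 /x_primeM [] /quo_class_eq0 e; apply/orP.
  by left; apply/eqP.
by right; apply/eqP.
Qed.
HB.instance Definition _ := GRing.ComUnitRing_isIntegral.Build D quo_dom_integral.

Definition quo_dom_class (a : R) : D := quo_class x a.
Fact quo_dom_class_zmod : zmod_morphism quo_dom_class.
Proof. exact: quo_class_zmod. Qed.
Fact quo_dom_class_monoid : monoid_morphism quo_dom_class.
Proof. exact: quo_class_monoid. Qed.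
HB.instance Definition _ :=
  GRing.isZmodMorphism.Build R D quo_dom_class quo_dom_class_zmod.
HB.instance Definition _ :=
  GRing.isMonoidMorphism.Build R D quo_dom_class quo_dom_class_monoid.

Definition quo_dom_id (a : quo x) : D := a.
Fact quo_dom_id_zmod : zmod_morphism quo_dom_id. Proof. by []. Qed.
Fact quo_dom_id_monoid : monoid_morphism quo_dom_id. Proof. by []. Qed.
HB.instance Definition _ :=
  GRing.isZmodMorphism.Build (quo x) D quo_dom_id quo_dom_id_zmod.
HB.instance Definition _ :=
  GRing.isMonoidMorphism.Build (quo x) D quo_dom_id quo_dom_id_monoid.

Variables (R' : comPzRingType) (g : {rmorphism R -> R'}).
Hypothesis quo_inj : forall a b, g a = g x * b -> exists c, a = x * c.
Hypothesis units : forall d, ~ principal x d ->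
  exists u, quo_class (g x) (g d) * quo_class (g x) u = 1.
Hypothesis fractions : forall b : quo (g x), exists p : R * R,
  ~ principal x p.2 /\ quo_class (g x) (g p.2) * b = quo_class (g x) (g p.1).

Local Notation cl := quo_dom_class.
Local Notation cl' := (quo_class (g x)).

Lemma quo_class_base_inj a b : cl' (g a) = cl' (g b) -> cl a = cl b.
Proof.
move=> /quo_classP [c e]; apply/quo_classP.
by have [|d ->] := @quo_inj (a - b) c; [rewrite rmorphB e mulrC|exists d; rewrite mulrC].
Qed.

Lemma tofrac_class_neq0 d : ~ principal x d -> tofrac (cl d) != 0.
Proof. by move=> dx; rewrite tofrac_eq0; apply/eqP => /quo_class_eq0. Qed.

Definition quo_frac (b : quo (g x)) : {fraction D} :=
  let p := sval (cid (fractions b)) in tofrac (cl p.1) / tofrac (cl p.2).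

(** The choice of a fraction does not matter: after cross-multiplication two fractions for [b] agree
    in B, and A -> B is injective. *)
Lemma quo_fracE b c d : ~ principal x d -> cl' (g d) * b = cl' (g c) ->
  quo_frac b = tofrac (cl c) / tofrac (cl d).
Proof.
move=> dx e; rewrite /quo_frac; case: cid => -[c' d'] /= [dx' e'].
apply/eqP; rewrite eqr_div ?tofrac_class_neq0 // -!tofracM -!rmorphM tofrac_eq.
apply/eqP; apply: quo_class_base_inj; rewrite !rmorphM /= -e -e'.
by rewrite mulrAC [RHS]mulrAC (mulrC (cl' (g d'))).
Qed.

Fact quo_frac_zmod : zmod_morphism quo_frac.
Proof.
move=> b b'; have [[c d] /= [dx e]] := fractions b.
have [[c' d'] /= [dx' e']] := fractions b'.
have dd'x : ~ principal x (d * d') by move=> /x_primeM [].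
rewrite (quo_fracE dx e) (quo_fracE dx' e').
rewrite (@quo_fracE _ (c * d' - c' * d) (d * d')) //; last first.
  by rewrite !(rmorphM, rmorphB) /= -e -e'; ring.
rewrite -(mulNr (tofrac (cl c'))) addf_div ?tofrac_class_neq0 // mulNr.
by rewrite !(rmorphM, rmorphB) /=.
Qed.

Fact quo_frac_monoid : monoid_morphism quo_frac.
Proof.
split.
  rewrite (@quo_fracE _ 1 1); first by rewrite rmorph1 divff ?tofrac_eq0 ?oner_neq0.
    exact: x_prime1.
  by rewrite mulr1.
move=> b b'; have [[c d] /= [dx e]] := fractions b.
have [[c' d'] /= [dx' e']] := fractions b'.
have dd'x : ~ principal x (d * d') by move=> /x_primeM [].
rewrite (quo_fracE dx e) (quo_fracE dx' e') (@quo_fracE _ (c * c') (d * d')) //.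
  by rewrite !rmorphM mulf_div.
by rewrite !rmorphM /= -e -e'; ring.
Qed.
HB.instance Definition _ :=
  GRing.isZmodMorphism.Build (quo (g x)) {fraction D} quo_frac quo_frac_zmod.
HB.instance Definition _ :=
  GRing.isMonoidMorphism.Build (quo (g x)) {fraction D} quo_frac quo_frac_monoid.

Lemma quo_map_fraction_field : is_fraction_field (quo_map g x).
Proof.
exists D, quo_dom_id, quo_frac; split.
- by exists (fun a => a).
- have surj z : exists b, quo_frac b = z.
    have [p [q [q0 zq]]] := fraction_rep z.
    elim/quo_ind: p zq => c; elim/quo_ind: q q0 => d d0 zq.
    have dx : ~ principal x d by move=> /quo_class_eq0 e; rewrite e eqxx in d0.
    have [u du] := units dx; exists (cl' u * cl' (g c)).
    rewrite (@quo_fracE _ c d) //; last by rewrite mulrA du mul1r.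
    have -> : tofrac (cl c) = z * tofrac (cl d) by exact: (esym zq).
    by rewrite mulfK ?tofrac_class_neq0.
  have inj0 b : quo_frac b = 0 -> b = 0.
    have [[c d] /= [dx e]] := fractions b; rewrite (quo_fracE dx e) => /eqP.
    rewrite mulf_eq0 invr_eq0 (negbTE (tofrac_class_neq0 dx)) orbF tofrac_eq0.
    move=> /eqP /quo_class_eq0 [k ek]; have [u du] := units dx.
    rewrite -[b]mul1r -du mulrAC e ek rmorphM rmorphM /=.
    have -> : cl' (g x) = 0 by apply/quo_classP; exists 1; rewrite subr0 mul1r.
    by rewrite mulr0 mul0r.
  have [h hK] := choice surj; exists h => // b.
  by apply/eqP; rewrite -subr_eq0; apply/eqP/inj0; rewrite rmorphB /= hK subrr.
- move=> q; elim/quo_ind: q => a; rewrite /= quo_mapE (@quo_fracE _ a 1).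
  + by rewrite rmorph1 divr1.
  + exact: x_prime1.
  + by rewrite !rmorph1 mul1r.
Qed.

End PrimeQuotient.

(** * Consequences of patching *)

(* As [x] is not in [M^2], neither [e] nor any [f - a e] lies in [M V], so some linear
   forms take unit values on them; these forms divide the relation [xv] by [x]. *)
Lemma dual_basis_span_mod (R : comPzRingType) (M : set R) (V : lmodType R)
    (x : R) (s q : {linear V -> R^o}) (e f : V) :
  local_with M -> ~ ideal_mul M M x -> fg_projective V ->
  s e = x -> q e = 0 -> q f = x ->
  (forall v, x *: v = (s v : R) *: e + (q v : R) *: f) ->
  (forall v, M (s v)) -> (forall v, M (q v)) ->
  forall v, exists d, q v = x * d.
Proof.
move=> R_local xM2 /fg_projective_dual_basis [n [w [phi wphi]]].
move=> se qe qf xv sM qM v.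
have x_comb (l : {linear V -> R^o}) u : (forall v, M (l v)) -> l u = x ->
    exists j, ~ M (phi j u).
  move=> lM lu; apply: contrapT => /forallNP nM; apply: xM2.
  rewrite -lu (wphi u) linear_sum.
  exists n, (fun j => phi j u), (fun j => l (w j)); split=> // [j|].
    exact: contrapT (nM j).
  by apply: eq_bigr => j _; rewrite linearZ.
have [j /(local_unit R_local) [u1 e1]] := x_comb s e sM se.
(* With f' in place of f, the matrix of phi_j, phi_k on e, f' is triangular with units on the
   diagonal. Applying phi_j and then phi_k to x v shows both coefficients to be divisible by x. *)
pose f' := f - (u1 * phi j f) *: e.
have qf' : q f' = x.
  by rewrite linearB linearZ_LR qe qf scaler0 subr0.
have [k /(local_unit R_local) [u2 e2]] := x_comb q f' qM qf'.
have phif' : phi j f' = 0.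
  rewrite linearB linearZ_LR -[X in _ - X]/(u1 * phi j f * phi j e).
  by rewrite mulrAC e1 mul1r subrr.
have xv' : x *: v = (s v + q v * (u1 * phi j f)) *: e + (q v : R) *: f'.
  rewrite xv scalerDl scalerBr scalerA -addrA; congr (_ + _).
  by rewrite addrC subrK.
have E1 : x * phi j v = (s v + q v * (u1 * phi j f)) * phi j e.
  have := congr1 (phi j) xv'; rewrite linearD !linearZ_LR phif' scaler0 addr0.
  exact.
have E2 : x * phi k v = (s v + q v * (u1 * phi j f)) * phi k e + q v * phi k f'.
  have := congr1 (phi k) xv'; rewrite linearD !linearZ_LR; exact.
exists (u2 * (phi k v - u1 * phi j v * phi k e)).
transitivity (u2 * (x * phi k v - u1 * (x * phi j v) * phi k e)); last by ring.
rewrite E1 E2.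
transitivity ((q v : R) * (u2 * phi k f') +
    u2 * (s v + q v * (u1 * phi j f)) * phi k e * (1 - u1 * phi j e)).
  by rewrite e1 e2; ring.
by ring.
Qed.

Section Regular.
Variables (R S : comPzRingType) (f : {rmorphism R -> S}).

Definition bc_coord : {linear bc f R^o -> S^o} := bc_form f (lin_id R^o).

Lemma bc_coordE r s : bc_coord (tens f r s) = s * f r.
Proof. exact: bc_formE. Qed.

Lemma bc_coordK t : (bc_coord t : S) *: tens f (1 : R^o) 1 = t.
Proof.
elim/bc_ind: t => [r|a t e|t u e e'].
- rewrite bc_coordE mul1r -tens_scalel; congr tens; exact: mulr1.
- by rewrite linearZ_LR -[in RHS]e scalerA.
- by rewrite linearD scalerDl e e'.
Qed.

Lemma bc_coord_inj t u : bc_coord t = bc_coord u -> t = u.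
Proof. by move=> e; rewrite -(bc_coordK t) e bc_coordK. Qed.

End Regular.

(** * Planes glued along an elementary matrix *)

Definition plane (A : comPzRingType) : lmodType A := (A^o * A^o)%type.

Section Plane.
Variable A : comPzRingType.

Fact plane_fst_linear : linear (fun p : plane A => p.1 : A^o). Proof. by []. Qed.
Fact plane_snd_linear : linear (fun p : plane A => p.2 : A^o). Proof. by []. Qed.
Definition plane_fst : {linear plane A -> A^o} := linear_of plane_fst_linear.
Definition plane_snd : {linear plane A -> A^o} := linear_of plane_snd_linear.
Definition plane1 : plane A := (1, 0).
Definition plane2 : plane A := (0, 1).

Lemma plane_decomp (p : plane A) :
  p = (plane_fst p : A) *: plane1 + (plane_snd p : A) *: plane2.
Proof.
case: p => a b; congr pair => /=.
  by rewrite scaler0 addr0; exact/esym/mulr1.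
by rewrite scaler0 add0r; exact/esym/mulr1.
Qed.

Lemma plane_ext (p p' : plane A) :
  plane_fst p = plane_fst p' -> plane_snd p = plane_snd p' -> p = p'.
Proof. by case: p p' => [a b] [a' b'] e1 e2; congr pair. Qed.

Lemma plane_fg_projective : fg_projective (plane A).
Proof.
apply: (@dual_basis_fg_projective _ _ 2
  (fun i => if i == ord0 then plane1 else plane2)
  (fun i => if i == ord0 then plane_fst else plane_snd)) => p.
by rewrite !big_ord_recl big_ord0 addr0 /= {1}(plane_decomp p).
Qed.

Variables (S : comPzRingType) (f : {rmorphism A -> S}).

Definition bc_fst : {linear bc f (plane A) -> S^o} := bc_form f plane_fst.
Definition bc_snd : {linear bc f (plane A) -> S^o} := bc_form f plane_snd.

Lemma bc_plane_decomp t :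
  t = (bc_fst t : S) *: tens f plane1 1 + (bc_snd t : S) *: tens f plane2 1.
Proof.
elim/bc_ind: t => [p|a t {1}->|t u {1}-> {1}->].
- by rewrite !bc_formE !mul1r {1}(plane_decomp p) tensDl !tens_scalel.
- by rewrite scalerDr !scalerA !linearZ_LR.
- by rewrite !linearD !scalerDl addrACA.
Qed.

Lemma bc_plane_inj t u : bc_fst t = bc_fst u -> bc_snd t = bc_snd u -> t = u.
Proof. by move=> e1 e2; rewrite (bc_plane_decomp t) e1 e2 -bc_plane_decomp. Qed.

Lemma bc_plane_comb (a b : S) :
  bc_fst (a *: tens f plane1 1 + b *: tens f plane2 1) = a /\
  bc_snd (a *: tens f plane1 1 + b *: tens f plane2 1) = b.
Proof.
rewrite !linearD !linearZ_LR !bc_formE !mul1r /= !rmorph0 !rmorph1 !scaler0.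
by rewrite addr0 add0r; split; exact: mulr1.
Qed.

End Plane.

Arguments plane_fst {A}.
Arguments plane_snd {A}.

Section Twist.
Variables (A B S : comPzRingType) (f : {rmorphism A -> S}) (h : {rmorphism B -> S}).
Variable beta : S.

Definition twist_fun (t : bc f (plane A)) : bc h (plane B) :=
  ((bc_fst f t : S) + beta * bc_snd f t) *: tens h (plane1 B) 1 +
  (bc_snd f t : S) *: tens h (plane2 B) 1.

Fact twist_linear : linear twist_fun.
Proof.
move=> a t u; rewrite /twist_fun (linearP (bc_fst f)) (linearP (bc_snd f)).
rewrite scalerDr !scalerA addrACA -!scalerDl.
congr (_ *: _ + _ *: _).
by rewrite -[a *: bc_fst f t]/(a * bc_fst f t) -[a *: bc_snd f t]/(a * bc_snd f t); ring.
Qed.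

Definition twist : {linear bc f (plane A) -> bc h (plane B)} := linear_of twist_linear.

Lemma twist_fst t : bc_fst h (twist t) = bc_fst f t + beta * bc_snd f t :> S.
Proof. exact: (bc_plane_comb _ _ _).1. Qed.
Lemma twist_snd t : bc_snd h (twist t) = bc_snd f t.
Proof. exact: (bc_plane_comb _ _ _).2. Qed.

End Twist.

Lemma twist_bij (A B S : comPzRingType) (f : {rmorphism A -> S})
  (h : {rmorphism B -> S}) (beta : S) : bijective (twist f h beta).
Proof.
exists (twist h f (- beta)) => t; apply: bc_plane_inj;
  by rewrite ?(twist_fst, twist_snd) // mulNr ?addrK ?addrNK.
Qed.

Section MilnorLocalization.
Variables (R R' : comPzRingType) (x : R) (g : {rmorphism R -> R'}).
Hypotheses (x_reg : GRing.lreg x) (gx_reg : GRing.lreg (g x)).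
Local Notation sq := (loc_square g x).
Local Notation h1 := (loc_ind_map g x).
Local Notation h2 := (loc_map (g x)).
Hypothesis milnor : milnor_patching_diagram sq.

(* An isomorphism of the pullback ring with [R] as [R]-modules maps 1 to a unit of [R]. *)
Lemma milnor_quo_inj a b : g a = g x * b -> exists c, a = x * c.
Proof.
move=> ab; have [theta [thetaI thetaK thetaIK]] := milnor_glue_unit_base milnor.
pose X : patching_datum sq := F_ob (R^o : lmodType (sqR sq)).
have mk (s1 : loc x) (s2 : R') : h1 s1 = h2 s2 -> exists z : glue X,
    bc_coord (loc_map x) (glue_fst z) = s1 /\ bc_coord g (glue_snd z) = s2.
  move=> s12.
  have [|z [z1 z2]] := @glue_exists _ X (s1 *: tens (loc_map x) (1 : R^o) 1)
     (s2 *: tens g (1 : R^o) 1).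
    rewrite !tens_scalel linearZ [pd_iso X _]base_isoE.
    by congr (_ *: _).
  exists z; rewrite z1 z2; split.
    by rewrite linearZ bc_coordE mul1r rmorph1; exact: mulr1.
  by rewrite linearZ bc_coordE mul1r rmorph1; exact: mulr1.
have ext (z w : glue X) :
    bc_coord (loc_map x) (glue_fst z) = bc_coord (loc_map x) (glue_fst w) ->
    bc_coord g (glue_snd z) = bc_coord g (glue_snd w) -> z = w.
  by move=> e1 e2; apply: glue_ext; apply: bc_coord_inj.
have fstZ r (z : glue X) : bc_coord (loc_map x) (glue_fst (r *: z)) =
    loc_map x r * bc_coord (loc_map x) (glue_fst z).
  by rewrite glue_fstZ linearZ_LR.
have sndZ r (z : glue X) : bc_coord g (glue_snd (r *: z)) =
    g r * bc_coord g (glue_snd z).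
  by rewrite glue_sndZ linearZ_LR.
pose o := @glue_unit sq (R^o : lmodType (sqR sq)) (1 : R).
have o1 : bc_coord (loc_map x) (glue_fst o) = 1.
  by rewrite bc_coordE mul1r rmorph1.
have o2 : bc_coord g (glue_snd o) = 1 by rewrite bc_coordE mul1r rmorph1.
pose r : sqR sq := theta o; pose beta := thetaI (1 : R).
have rbeta : o = r *: beta.
  apply: (can_inj thetaK); rewrite linearZ_LR thetaIK -/r; exact/esym/mulr1.
pose s1 := bc_coord (loc_map x) (glue_fst beta); pose s2 := bc_coord g (glue_snd beta).
have rs1 : loc_map x r * s1 = 1 by rewrite -o1 rbeta fstZ.
have rs2 : g r * s2 = 1 by rewrite -o2 rbeta sndZ.
have s12 : h1 s1 = h2 s2.
  have := congr1 (bc_form h2 (bc_form g (lin_id R^o))) (glue_compat beta).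
  by rewrite [LHS](@base_iso_form sq) !bc_formE !mul1r.
(* The pair (s1, s2) is the inverse of r in the fibre product. Its square w satisfies r w = [beta],
   so [theta w] inverts r in R. *)
have [|w [w1 w2]] := mk (s1 * s1) (s2 * s2); first by rewrite !rmorphM /= s12.
have rw : r *: w = beta.
  by apply: ext; rewrite (fstZ, sndZ) (w1, w2) mulrA (rs1, rs2) mul1r.
(* The fraction a / x and b agree in S, so they define z in the fibre product with x z = a times its
   unit element. *)
have [|z [z1 z2]] := mk (loc_frac x a 1) b.
  by rewrite loc_ind_mapE ab; have := loc_frac_mulX (g x) 1 b; rewrite expr1.
have xz : (x : sqR sq) *: z = (a : sqR sq) *: o.
  apply: ext; rewrite (fstZ, sndZ) (fstZ, sndZ) (z1, z2) (o1, o2) mulr1.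
    by have := loc_clear x 1 a; rewrite expr1.
  by rewrite ab.
have ru : (r : R) * theta w = 1.
  by have := congr1 theta rw; rewrite linearZ_LR thetaIK.
exists (theta z * theta w).
have : x * theta z = a * r :> R.
  by have := congr1 theta xz; rewrite !linearZ_LR.
by move=> e; rewrite mulrA e -mulrA ru mulr1.
Qed.

Section Twisted.
Variable b : R'.

Definition twisted_plane : patching_datum sq :=
  @PatchingDatum sq (plane _) (plane _) (twist h1 h2 (loc_frac (g x) b 1))
    (twist_bij h1 h2 (loc_frac (g x) b 1)).

Variable M : set R.
Hypotheses (R_local : local_with M) (xM : M x) (xM2 : ~ ideal_mul M M x).

(** The second coordinates of a glued vector agree and give [q] in R. The first coordinate over R_x
    has a simple pole, removed by x, which gives [s] in R with g(s) + b g(q) in x'R'. In these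
    coordinates [e] and [f] are (x, 0) and (0, x). *)
Lemma milnor_dichotomy :
  (exists c w, b = g c + g x * w) \/ (exists c w, g c * b = 1 + g x * w).
Proof.
apply: contrapT => /not_orP [nb nb'].
pose X := twisted_plane.
have Xfg : pd_fg_projective X by split; exact: plane_fg_projective.
pose V : lmodType R := G_functor sq X.
pose m1 (z : V) : plane (loc x) := @glue_fst sq X z.
pose m2 (z : V) : plane R' := @glue_snd sq X z.
pose beta := loc_frac (g x) b 1.
have xbeta : h2 (g x) * beta = h2 b.
  by have := loc_clear (g x) 1 b; rewrite expr1.
have m1P r u v : m1 (r *: u + v) = loc_map x r *: m1 u + m1 v.
  exact: (@glue_fstP sq X r u v).
have m2P r u v : m2 (r *: u + v) = g r *: m2 u + m2 v.
  exact: (@glue_sndP sq X r u v).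
have compat z : twist h1 h2 beta (tens h1 (m1 z) 1) = tens h2 (m2 z) 1.
  exact: (@glue_compat sq X).
have compat1 z : h1 (plane_fst (m1 z)) + beta * h1 (plane_snd (m1 z)) =
    h2 (plane_fst (m2 z)).
  have := congr1 (bc_fst h2) (compat z); rewrite twist_fst !bc_formE !mul1r.
  exact.
have compat2 z : h1 (plane_snd (m1 z)) = h2 (plane_snd (m2 z)).
  have := congr1 (bc_snd h2) (compat z); rewrite twist_snd !bc_formE !mul1r.
  exact.
have mk (p1 : plane (loc x)) (p2 : plane R') :
    h1 (plane_fst p1) + beta * h1 (plane_snd p1) = h2 (plane_fst p2) ->
    h1 (plane_snd p1) = h2 (plane_snd p2) -> exists z, m1 z = p1 /\ m2 z = p2.
  move=> e1 e2; apply: (@glue_exists sq X); apply: bc_plane_inj.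
    by rewrite [LHS]twist_fst !bc_formE !mul1r.
  by rewrite [LHS]twist_snd !bc_formE !mul1r.
have ext z w : m1 z = m1 w -> m2 z = m2 w -> z = w by exact: (@glue_ext sq X).
have [||q qP] := @loc_pullback_linear _ _ g x x_reg gx_reg milnor_quo_inj V
    (fun z => plane_snd (m1 z)) (fun z => plane_snd (m2 z)) _ _ compat2.
- by move=> r u v; rewrite m1P linearP.
- by move=> r u v; rewrite m2P linearP.
have [|||s sP] := @loc_pullback_linear _ _ g x x_reg gx_reg milnor_quo_inj V
    (fun z => loc_map x x * plane_fst (m1 z))
    (fun z => g x * plane_fst (m2 z) - b * plane_snd (m2 z)).
- by move=> r u v; rewrite m1P linearP mulrDr; congr (_ + _); exact: mulrCA.
- move=> r u v; rewrite m2P !linearP.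
  by rewrite -![g r *: _]/(g r * _); ring.
- move=> z; rewrite rmorphM /= loc_squareE rmorphB !rmorphM /= -compat1 -compat2.
  by rewrite mulrDr mulrA xbeta addrK.
have m1Z r u : m1 (r *: u) = loc_map x r *: m1 u by exact: (@glue_fstZ sq X r u).
have m2Z r u : m2 (r *: u) = g r *: m2 u by exact: (@glue_sndZ sq X r u).
have locI := loc_map_inj x_reg.
have [||e [e1 e2]] := mk (1, 0) (1, 0).
- by rewrite /= !rmorph0 mulr0 addr0 !rmorph1.
- by rewrite /= !rmorph0.
have [||f [f1 f2]] := mk (0, loc_map x x) (b, g x).
- by rewrite /= rmorph0 add0r loc_squareE mulrC.
- by rewrite /= loc_squareE.
have se : s e = x by apply: locI; rewrite -(sP e).1 e1 /= mulr1.
have qe : q e = 0 by apply: locI; rewrite -(qP e).1 e1 rmorph0.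
have qf : q f = x by apply: locI; rewrite -(qP f).1 f1.
have xv v : x *: v = (s v : R) *: e + (q v : R) *: f.
  have sx : loc_map x (s v) = loc_map x x * plane_fst (m1 v) by case: (sP v).
  have sx' : g (s v) = g x * plane_fst (m2 v) - b * plane_snd (m2 v).
    by case: (sP v).
  have qx : loc_map x (q v) = plane_snd (m1 v) by case: (qP v).
  have qx' : g (q v) = plane_snd (m2 v) by case: (qP v).
  apply: ext.
    rewrite m1P !m1Z e1 f1; apply: plane_ext; rewrite linearP !linearZ_LR /=.
      by rewrite scaler0 addr0 sx; apply/esym/mulr1.
    rewrite scaler0 add0r qx; exact: mulrC.
  rewrite m2P !m2Z e2 f2; apply: plane_ext; rewrite linearP !linearZ_LR /=.
    transitivity ((g x * plane_fst (m2 v) - b * plane_snd (m2 v)) * 1 +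
        plane_snd (m2 v) * b); last by rewrite -sx' -qx'.
    transitivity (g x * plane_fst (m2 v)); [by []|ring].
  by rewrite scaler0 add0r qx'; exact: mulrC.
have sg v : g (s v) + b * g (q v) = g x * plane_fst (m2 v).
  by rewrite -(sP v).2 -(qP v).2 subrK.
(* Modulo x' one has s + bq = 0. If s is a unit, -q/s is an inverse of b; if q is a unit, b = -s/q.
   Both are excluded by assumption. *)
have sM v : M (s v).
  apply: contrapT => /(local_unit R_local) [u us]; apply: nb'.
  exists (- (q v * u)), (- (plane_fst (m2 v) * g u)).
  have us' : g u * g (s v) = 1 by rewrite -rmorphM us rmorph1.
  transitivity (g u * g (s v) - (g (s v) + b * g (q v)) * g u).
    by rewrite rmorphN rmorphM; ring.
  by rewrite us' sg; ring.
have qM v : M (q v).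
  apply: contrapT => /(local_unit R_local) [u uq]; apply: nb.
  exists (- (s v * u)), (plane_fst (m2 v) * g u).
  have uq' : g u * g (q v) = 1 by rewrite -rmorphM uq rmorph1.
  transitivity (b * (g u * g (q v))); first by rewrite uq' mulr1.
  by rewrite (mulrA (g x)) -sg rmorphN rmorphM; ring.
have qx := dual_basis_span_mod R_local xM2 (milnor_glue_fg_projective milnor Xfg)
  se qe qf xv sM qM.
(* The second coordinates of the glueing now lie in x'R'. For them to generate (0, 1), x' would have
   to be a unit of R', and then x a unit of R by [milnor_quo_inj]. *)
have [||d d1] := @milnor_snd_span sq milnor X
    (fun p : plane R' => exists d, plane_snd p = g x * d) Xfg _ _ (plane2 R').
- split; first by exists 0; rewrite mulr0.
  + by move=> u v [d du] [d' dv]; exists (d + d'); rewrite linearD du dv mulrDr.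
  + by move=> a u [d du]; exists (a * d); rewrite linearZ_LR du; exact: mulrCA.
- move=> z; have [d qd] := qx z; exists (g d).
  by rewrite -rmorphM -qd; case: (qP z).
have [|c c1] := @milnor_quo_inj 1 d; first by rewrite rmorph1.
apply: (local_proper R_local); rewrite c1 mulrC.
by case: (local_ideal R_local) => _ _; exact.
Qed.

End Twisted.

End MilnorLocalization.

(** * The residual map *)

Section QuotientMap.
Variables (R R' : comPzRingType) (x : R) (g : {rmorphism R -> R'}).

Lemma quo_map_bijP : bijective (quo_map g x) <->
  (forall a b, g a = g x * b -> exists c, a = x * c) /\ quo_surjective x g.
Proof.
split=> [[k mapK kK]|[qinj qsurj]].
  split=> [a b ab|r].
    have : quo_class x a = quo_class x 0.
      apply: (can_inj mapK); rewrite !quo_mapE; apply/quo_classP.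
      by exists b; rewrite rmorph0 subr0 ab mulrC.
    by move=> /quo_classP [c]; rewrite subr0 => ->; exists c; rewrite mulrC.
  have := kK (quo_class (g x) r); elim/quo_ind: (k _) => c.
  rewrite quo_mapE => /quo_classP [w e]; exists c, (- w).
  by rewrite mulrN mulrC -e opprB addrC subrK.
have surj q' : exists q, quo_map g x q = q'.
  elim/quo_ind: q' => r; have [c [w rw]] := qsurj r; exists (quo_class x c).
  by rewrite quo_mapE; apply/quo_classP; exists (- w); rewrite rw; ring.
have inj : injective (quo_map g x).
  elim/quo_ind=> a; elim/quo_ind=> b; rewrite !quo_mapE => /quo_classP [c e].
  apply/quo_classP; have [|d ed] := qinj (a - b) c; first by rewrite rmorphB e mulrC.
  by exists d; rewrite ed mulrC.
by have [k kK] := choice surj; exists k => // q; apply: inj; rewrite kK.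
Qed.

Hypothesis quo_inj : forall a b, g a = g x * b -> exists c, a = x * c.

Lemma quo_unit_mul d d' : quo_unit x g d -> quo_unit x g d' -> quo_unit x g (d * d').
Proof.
move=> [u [v e]] [u' [v' e']]; exists (u * u'), (v + v' + g x * v * v').
transitivity ((g d * u) * (g d' * u')); first by rewrite rmorphM; ring.
by rewrite e e'; ring.
Qed.

Lemma quo_unit1 : quo_unit x g 1.
Proof. by exists 1, 0; rewrite rmorph1; ring. Qed.

Lemma quo_unit_congr c a d :
  quo_unit x g d -> (exists v, d = c * a + x * v) -> quo_unit x g a.
Proof.
move=> [u [v e]] [w ed]; exists (g c * u), (v - g w * u).
transitivity (g d * u - g x * g w * u); last by rewrite e; ring.
by rewrite ed rmorphD !rmorphM; ring.
Qed.

Lemma quo_unit_cancel d r w : quo_unit x g d -> g d * r = g x * w ->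
  exists s, r = g x * s.
Proof.
move=> [u [v e]] dr; exists (w * u - v * r).
transitivity ((g d * u) * r - g x * v * r); first by rewrite e; ring.
by rewrite mulrAC dr; ring.
Qed.

Lemma quo_fractions_of_single :
  (forall r : R', exists d c, quo_unit x g d /\ exists w, g d * r = g c + g x * w) ->
  quo_fractions x g.
Proof.
move=> single; elim=> [|k ih] r.
  by exists 1, (fun=> 0); split; [exact: quo_unit1|case].
have [d [c [du dc]]] := ih (fun i => r (lift ord0 i)).
have [d0 [c0 [d0u [w0 dc0]]]] := single (r ord0).
exists (d * d0).
exists (fun i => if unlift ord0 i is Some j then d0 * c j else d * c0).
split=> [|i]; first exact: quo_unit_mul.
case: unliftP => [j|] ->.
  have [w e] := dc j; exists (g d0 * w).
  transitivity (g d0 * (g d * r (lift ord0 j))); first by rewrite rmorphM; ring.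
  by rewrite e rmorphM; ring.
exists (g d * w0).
transitivity (g d * (g d0 * r ord0)); first by rewrite rmorphM; ring.
by rewrite dc0 rmorphM; ring.
Qed.

Lemma quo_surjective_fractions : quo_surjective x g -> quo_fractions x g.
Proof.
move=> surj; apply: quo_fractions_of_single => r; have [c [w ->]] := surj r.
by exists 1, c; split; [exact: quo_unit1|exists w; rewrite rmorph1 mul1r].
Qed.

(** * The case where B is the fraction field of A *)

Section FractionField.
Hypothesis frac : is_fraction_field (quo_map g x).

Lemma frac_quo_inj a b : g a = g x * b -> exists c, a = x * c.
Proof.
have [D [u [v [u_bij v_bij vE]]]] := frac; move=> ab.
have : quo_class x a = 0.
  apply: (bij_inj u_bij); rewrite rmorph0; apply/eqP; rewrite -tofrac_eq0.
  rewrite -vE /= quo_mapE; apply/eqP; rewrite -[RHS](rmorph0 v); congr (v _).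
  by apply/quo_classP; exists b; rewrite subr0 ab mulrC.
by move=> /quo_class_eq0 /principalP.
Qed.

Lemma frac_domain a b : (exists d, a * b = x * d) ->
  (exists d, a = x * d) \/ (exists d, b = x * d).
Proof.
have [D [u [v [u_bij v_bij vE]]]] := frac.
move=> /principalP /quo_class_eq0 /(congr1 u); rewrite rmorphM rmorphM rmorph0.
have u0 c : u (quo_class x c) = 0 -> exists d, c = x * d.
  rewrite -(rmorph0 u) => /(bij_inj u_bij) /quo_class_eq0 /principalP; exact.
by move=> /eqP; rewrite mulf_eq0 => /orP [] /eqP /u0; [left|right].
Qed.

Lemma frac_unit d : ~ (exists e, d = x * e) -> quo_unit x g d.
Proof.
have [D [u [v [u_bij [k vK kK] vE]]]] := frac; move=> dx.
have d0 : tofrac (u (quo_class x d)) != 0.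
  rewrite tofrac_eq0; apply/eqP; rewrite -(rmorph0 u) => /(bij_inj u_bij).
  by move=> /quo_class_eq0 /principalP.
have := kK (tofrac (u (quo_class x d)))^-1; elim/quo_ind: (k _) => r vr.
have : quo_class (g x) (g d * r) = quo_class (g x) 1.
  apply: (can_inj vK); rewrite rmorphM rmorphM /= -(quo_mapE g x d) vE vr divff //.
  by rewrite !rmorph1.
by move=> /quo_classP [w e]; exists r, w; rewrite (mulrC (g x)) -e addrC subrK.
Qed.

Lemma frac_fractions : quo_fractions x g.
Proof.
have [D [u [v [[u' uK u'K] v_bij vE]]]] := frac.
apply: quo_fractions_of_single => r.
have [p [q [q0 e]]] := fraction_rep (v (quo_class (g x) r)).
move: q0 e; rewrite -(u'K p) -(u'K q); elim/quo_ind: (u' p) => c.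
elim/quo_ind: (u' q) => d d0; rewrite -!vE /= !quo_mapE -rmorphM => /(bij_inj v_bij).
rewrite -rmorphM => /quo_classP [w e]; exists d, c; split.
  apply: frac_unit => /principalP /quo_class_eq0 dx.
  by rewrite dx rmorph0 eqxx in d0.
by exists w; rewrite mulrC (mulrC (g x)) -e addrC subrK.
Qed.

Variable M : set R.
Hypotheses (R_noeth : noetherian R) (R_local : local_with M) (xM : M x).

Lemma frac_valuation y : M y -> (forall m, M m -> exists a b, m = a * y + x * b) ->
  quo_valuation M x g.
Proof.
move=> yM M_xy n c cx.
(* If y is a multiple of x, then M = (x), so a coefficient outside (x) is already outside M and d =
   1 will do. Otherwise the powers of y are nonzero in A, hence invertible in B. *)
have [[e ye]|yx] := pselect (exists e, y = x * e).
  exists 1, c; split; first exact: quo_unit1.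
    by move=> i; exists 0; rewrite mul1r mulr0 addr0.
  apply: contrapT => /forallNP cM; apply: cx => i.
  have /contrapT /M_xy [a [b ->]] := cM i.
  by exists (a * e + b); rewrite ye; ring.
have y_reg a : (exists b, y * a = x * b) -> exists b, a = x * b.
  by move=> /frac_domain [].
have [m [c' [cc' c'M]]] := quo_factor R_noeth R_local yM M_xy y_reg cx.
exists (y ^+ m), c'; split=> //; elim: m {cc'} => [|m ih]; first exact: quo_unit1.
by rewrite exprS; apply: quo_unit_mul => //; exact: frac_unit.
Qed.

End FractionField.

End QuotientMap.

(** In x = c a_0 + d a_1 one of c, d is a unit, as otherwise x would lie in M^2. The generator with
    the unit coefficient can be exchanged for x. *)
Lemma two_generators_regular_parameter (R : comPzRingType) (M : set R)
    (a : 'I_2 -> R) (x : R) :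
  local_with M -> M = ideal_gen a -> M x -> ~ ideal_mul M M x ->
  exists y, M y /\ forall m, M m -> exists c d, m = c * y + x * d.
Proof.
move=> R_local Ma xM xM2; have [_ MD MM] := local_ideal R_local.
have aM i : M (a i) by rewrite Ma; exact: ideal_gen_mem.
have gen m : M m -> exists c d, m = c * a ord0 + d * a (lift ord0 ord0).
  rewrite Ma => -[c ->]; exists (c ord0), (c (lift ord0 ord0)).
  by rewrite !big_ord_recl big_ord0 addr0.
have [c [d xE]] := gen _ xM.
have [_ M2D _] := ideal_mul_ideal M (local_ideal R_local).
have [cM|/(local_unit R_local) [u uc]] := pselect (M c); last first.
  exists (a (lift ord0 ord0)); split=> // m /gen [c' [d' ->]].
  exists (d' - c' * u * d), (c' * u).
  rewrite xE; transitivity (c' * (u * c) * a ord0 + d' * a (lift ord0 ord0)).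
    by rewrite uc mulr1.
  by ring.
have [dM|/(local_unit R_local) [u ud]] := pselect (M d); last first.
  exists (a ord0); split=> // m /gen [c' [d' ->]].
  exists (c' - d' * u * c), (d' * u).
  rewrite xE; transitivity (c' * a ord0 + d' * (u * d) * a (lift ord0 ord0)).
    by rewrite ud mulr1.
  by ring.
by exfalso; apply: xM2; rewrite xE; apply: M2D; exact: ideal_mul_mem.
Qed.

Section Dichotomy.
Variables (R R' : comPzRingType) (M : set R) (x : R) (g : {rmorphism R -> R'}).
Hypotheses (R_noeth : noetherian R) (R_local : local_with M) (xM : M x).
Hypothesis x_reg : GRing.lreg x.
Hypothesis quo_inj : forall a b, g a = g x * b -> exists c, a = x * c.
Hypothesis dichotomy : forall b : R',
  (exists c w, b = g c + g x * w) \/ (exists c w, g c * b = 1 + g x * w).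

(** Apply the dichotomy to a/t in B. If it comes from A, then t divides a modulo x; if it is inverse
    to an element of A, then a divides t modulo x. *)
Lemma quo_unit_total a t : quo_unit x g t ->
  (exists c d, a = c * t + x * d) \/ (exists c d, t = c * a + x * d).
Proof.
move=> [u [v tu]]; case: (dichotomy (g a * u)) => -[c [w e]]; [left|right].
  have [|d ad] := @quo_inj (a - c * t) (w * g t - v * g a).
    rewrite rmorphB rmorphM.
    transitivity ((g c + g x * w) * g t - g c * g t - g x * v * g a); last by ring.
    rewrite -e; transitivity (g a * (g t * u) - g c * g t - g x * v * g a); last by ring.
    by rewrite tu; ring.
  by exists c, d; rewrite -ad addrC subrK.
have [|d td] := @quo_inj (t - c * a) (v * g (c * a) - w * g t).
  rewrite rmorphB rmorphM.
  transitivity (g t * (1 + g x * w) - g x * w * g t - g c * g a); first by ring.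
  rewrite -e; transitivity (g c * g a * (g t * u) - g x * w * g t - g c * g a).
    by ring.
  by rewrite tu; ring.
by exists c, d; rewrite -td addrC subrK.
Qed.

(* An element invertible modulo [g x] is comparable to every other one for divisibility
   modulo [x], so a common divisor is reached one element at a time. *)
Lemma quo_unit_divides n (a : 'I_n -> R) t : quo_unit x g t -> M t ->
  (forall i, M (a i)) -> exists y, [/\ quo_unit x g y, M y &
    forall i, exists c d, a i = c * y + x * d].
Proof.
move=> tu tM; elim: n => [|n ih] in a *; first by exists t; split=> // -[].
move=> aM; have [|y [yu yM ay]] := ih (fun i => a (lift ord0 i)).
  by move=> i; exact: aM.
have [a0|[c [d yc]]] := quo_unit_total (a ord0) yu.
  by exists y; split=> // i; case: (unliftP ord0 i) => [j|] ->.
exists (a ord0); split=> // [|i].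
  by apply: quo_unit_congr yu _; exists d; exact: yc.
case: (unliftP ord0 i) => [j|] ->; last by exists 1, 0; ring.
by have [c' [d' ->]] := ay j; exists (c' * c), (c' * d + d'); rewrite yc; ring.
Qed.

Lemma quo_dichotomy : ~ quo_surjective x g ->
  regular_local M 2 /\ is_fraction_field (quo_map g x).
Proof.
move=> /existsNP [b0 b0n]; have [_ MD MM] := local_ideal R_local.
(* As [b0] does not come from A, it is inverse to some t, which must lie in M. This t starts the
   search for a uniformizer y invertible in B. *)
have [//|[t [w tb]]] := dichotomy b0.
have tM : M t.
  apply: contrapT => /(local_unit R_local) [u ut]; apply: b0n.
  exists u, (g u * w); have ut' : g u * g t = 1 by rewrite -rmorphM ut rmorph1.
  transitivity (g u * (g t * b0)); last by rewrite tb; ring.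
  by rewrite mulrA ut' mul1r.
have tu : quo_unit x g t by exists b0, w.
have [n [a Ma]] := R_noeth (local_ideal R_local).
have [|y [yu yM ay]] := quo_unit_divides (a := a) tu tM.
  by move=> i; rewrite Ma; exact: ideal_gen_mem.
have M_xy m : M m -> exists c d, m = c * y + x * d.
  rewrite Ma => -[e ->]; have /choice [c /choice [d acd]] := ay.
  exists (\sum_i e i * c i), (\sum_i e i * d i).
  rewrite mulr_suml mulr_sumr -big_split; apply: eq_bigr => i _ /=.
  by rewrite {1}acd; ring.
have unit_reg d z : quo_unit x g d -> (exists b, d * z = x * b) -> exists b, z = x * b.
  move=> du [b dz]; have [|s zs] := @quo_unit_cancel _ _ _ _ d (g z) (g b) du.
    by rewrite -!rmorphM dz.
  exact: quo_inj zs.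
have y_reg z := unit_reg y z yu.
have y_x : ~ exists d, y = x * d.
  move=> yx; have [|d d1] := y_reg 1; first by rewrite mulr1.
  by apply: (not_mul_eq1 R_local xM); exists d.
have units d : ~ (exists e, d = x * e) -> quo_unit x g d.
  move=> /(quo_factor1 R_noeth R_local yM M_xy y_reg) [m [u [Mu [v dE]]]].
  have [u' uu] := local_unit R_local Mu.
  have ym : quo_unit x g (y ^+ m).
    elim: m {dE} => [|m ih]; first exact: quo_unit1.
    by rewrite exprS; exact: quo_unit_mul.
  apply: (quo_unit_congr (c := u') ym); exists (- u' * v); rewrite dE.
  transitivity (y ^+ m * (u' * u)); [by rewrite uu mulr1|ring].
split; first exact: regular_pair_regular_local R_noeth R_local xM yM M_xy y_reg x_reg y_x.
have xprime := prime_principal_x R_noeth R_local xM yM M_xy y_reg.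
apply: (quo_map_fraction_field xprime quo_inj).
  move=> d dx; have [|u [v e]] := units d; first by move/principalP.
  exists u; rewrite -rmorphM; apply/quo_classP; exists v.
  by rewrite e addrAC subrr add0r mulrC.
elim/quo_ind=> r; case: (dichotomy r) => -[c [v e]].
  exists (c, 1); split; first by case: xprime.
  rewrite /= rmorph1 rmorph1 mul1r; apply/quo_classP; exists v.
  by rewrite e addrAC subrr add0r mulrC.
exists (1, c); split=> /=; last first.
  rewrite -rmorphM rmorph1; apply/quo_classP; exists v.
  by rewrite e addrAC subrr add0r mulrC.
(* If x divided the denominator c, then c r = 1 modulo x' would make 1 a multiple of x', hence of
   x. *)
move=> /principalP [d cd]; apply: (not_mul_eq1 R_local xM).
apply: (@quo_inj 1 (g d * r - v)); rewrite rmorph1.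
transitivity (1 + g x * v - g x * v); first by ring.
by rewrite -e cd rmorphM; ring.
Qed.

End Dichotomy.

Theorem corollary1p8 (R R' : comPzRingType) (M : set R) (x : R)
    (g : {rmorphism R -> R'})
    (R_noeth : noetherian R) (R_local : local_with M)
    (xM : M x) (xM2 : ~ ideal_mul M M x)
    (x_reg : GRing.lreg x) (gx_reg : GRing.lreg (g x)) :
  milnor_patching_diagram (loc_square g x) <->
    (bijective (quo_map g x) \/
     (regular_local M 2 /\
      is_fraction_field (quo_map g x))).
Proof.
split=> [milnor|[/quo_map_bijP [qinj qsurj]|[[_ _ _ [a Ma]] frac]]].
- have qinj := milnor_quo_inj milnor.
  have [qsurj|nsurj] := pselect (quo_surjective x g).
    by left; apply/quo_map_bijP.
  right; apply: (quo_dichotomy R_noeth R_local xM x_reg qinj _ nsurj) => b.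
exact: (milnor_dichotomy x_reg gx_reg milnor b R_local xM xM2).
- apply: (loc_milnor_patching R_noeth R_local xM x_reg gx_reg qinj).
    exact: quo_surjective_fractions.
  by left.
- have [y [yM M_xy]] := two_generators_regular_parameter R_local Ma xM xM2.
  apply: (loc_milnor_patching R_noeth R_local xM x_reg gx_reg).
  + exact: frac_quo_inj.
  + exact: frac_fractions.
  + by right; apply: (frac_valuation frac R_noeth R_local yM M_xy).
Qed.
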